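(* For integers $k\ge 3$, $\ell\in[2,k-1]$ and every $\varepsilon>0$, there exist $\eta>0$ and an integer $C>0$ such that the following holds for all sufficiently large $n$ divisible by $k-\ell$. Suppose $H$ is a $k$-graph on $n$ vertices with at least $\varepsilon n^k$ edges and $p=p(n)\ge n^{-(k-\ell)-\eta}$. Then with high probability $H\cup G^{(k)}(n,p)$ contains a Hamilton $\ell$-cycle.
   Context: A $k$-graph is a hypergraph whose edges are $k$-element subsets of the vertex set. $G^{(k)}(n,p)$ is the binomial random $k$-graph on the vertex set of $H$, in which each $k$-subset is an edge independently with probability $p$; $H\cup G^{(k)}(n,p)$ has as edge set the union of the two edge sets. For $k>\ell\ge 1$, a $k$-uniform $\ell$-cycle is a $k$-graph whose vertices can be ordered cyclically $x_1,\dots,x_N$ such that each edge consists of $k$ consecutive vertices and any two consecutive edges intersect in exactly $\ell$ vertices; equivalently its edges are $\{x_{(k-\ell)i+1},\dots,x_{(k-\ell)i+k}\}$ for $i\in[N/(k-\ell)]$ (indices mod $N$). A Hamilton $\ell$-cycle in a $k$-graph is a spanning subgraph isomorphic to an $\ell$-cycle. ''With high probability'' means with probability tending to $1$ as $n\to\infty$. *)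

(* Defs.v *)
From HB Require Import structures.
From mathcomp Require Import all_boot all_order all_algebra.
From mathcomp Require Import all_classical all_reals all_analysis.

Set Implicit Arguments.
Unset Strict Implicit.
Unset Printing Implicit Defensive.

Import Order.TTheory GRing.Theory Num.Theory.
Import numFieldNormedType.Exports.
Local Open Scope ring_scope.

Section Hypergraphs.
Variable T : finType.
Implicit Types (G H C : {set {set T}}) (k l : nat).

Definition ksubsets k : {set {set T}} := [set e : {set T} | #|e| == k].

(* A k-graph with vertex set T is identified with its edge set. *)
Definition kgraph k G : bool := G \subset ksubsets k.

(* The set {x_{(k-l)i}, ..., x_{(k-l)i+k-1}}, for vertices x_0, ..., x_{N-1}
   and indices taken modulo N. *)
Definition lcycle_edge k l N (x : 'I_N -> T) (i : nat) : {set T} :=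
  [set x j | j : 'I_N & [exists m : 'I_k, j == ((k - l) * i + m) %% N :> nat]%N].

Definition lcycle_edges k l N (x : 'I_N -> T) : {set {set T}} :=
  [set lcycle_edge k l x i | i : 'I_(N %/ (k - l))].

(* An injection from 'I_#|T| to T is an ordering of the whole vertex set. *)
Definition is_lcycle k l C : bool :=
  [&& kgraph k C, (k - l %| #|T|)%N &
      [exists x : {ffun 'I_#|T| -> T},
         injectiveb x && (C == lcycle_edges k l x)]].

Definition has_hamilton_lcycle k l G : bool :=
  [exists C : {set {set T}}, (C \subset G) && is_lcycle k l C].

Section RandomGraph.
Variable R : realType.

(* Probability that the random k-graph on T in which every k-subset of T is an
   edge independently with probability p satisfies E. *)
Definition gnp_pr k (p : R) (E : pred {set {set T}}) : R :=
  \sum_(G : {set {set T}} | kgraph k G && E G)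
    \prod_(e in ksubsets k) (if e \in G then p else 1 - p).

Lemma gnp_pr_superset k (p : R) (S : {set {set T}}) :
  kgraph k S -> gnp_pr k p (fun G => S \subset G) = p ^+ #|S|.
Proof.
move=> kS.
pose F (e : {set T}) : R := if e \in ksubsets k then p else 0.
pose F' (e : {set T}) : R :=
  if e \in ksubsets k then (if e \in S then 0 else 1 - p) else 1.
transitivity (\prod_(e : {set T}) (F e + F' e)); last first.
  rewrite (bigID (mem S)) /= [X in _ * X]big1 ?mulr1 => [|e eS].
    rewrite (eq_bigr (fun=> p)) ?prodr_const // => e eS.
    by rewrite /F /F' (fintype.subsetP kS) // eS addr0.
  rewrite /F /F' (negPf eS).
  by case: ifP => _; rewrite ?add0r // addrC subrK.
rewrite bigA_distr /gnp_pr big_mkcond /=; apply: eq_bigr => G _.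
case: ifP => [/andP[kG SG]|/negbT].
  rewrite big_mkcond /=; apply: eq_bigr => e _.
  rewrite /F /F'; case: ifP => // ek; case: ifP => eG //.
    by rewrite (contraFF (fintype.subsetP SG e) eG).
  by rewrite (fintype.subsetP kG _ eG) in ek.
rewrite negb_and => /orP[] /fintype.subsetPn[e e1 e2].
  by rewrite (bigD1 e) //= e1 /F (negPf e2) mul0r.
by rewrite (bigD1 e) //= (negPf e2) /F' e1 (fintype.subsetP kS) // mul0r.
Qed.

Lemma gnp_pr_total k (p : R) : gnp_pr k p xpredT = 1.
Proof.
have := @gnp_pr_superset k p finset.set0; rewrite /kgraph finset.sub0set.
rewrite cards0 expr0 => <- //.
by apply: eq_bigl => G; rewrite finset.sub0set.
Qed.

End RandomGraph.
End Hypergraphs.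

(* The filter of "all sufficiently large n divisible by d". *)
Definition large_multiples (d : nat) : set_system nat :=
  within (fun n : nat => (d %| n)%N : Prop) (nbhs (\oo)%classic).

(* Main.v *)
Require Import Defs.
From mathcomp Require Import all_boot all_order all_algebra all_fingroup.
From mathcomp Require Import ring lra zify.
From mathcomp Require Import reals.

(** Fix a large constant [L]. Let [x] be a uniformly random cyclic ordering of the
    vertices among those for which every [L]-th window of the cycle is an edge of
    [H], and ask the random graph only for the other edges of the cycle. Since [H]
    is dense, prescribing the places of [v] vertices has probability at most
    [(C / n) ^ v]. A set of [t] requested edges forming [c] overlapping clusters
    spans at least [(k - l) t + c + t / (4 L)] vertices: each cluster gains
    [l >= 2] vertices at its end, and the windows left to [H] interrupt every run
    of consecutive edges within [2 L] steps. As it can be placed in at most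
    [n ^ c * O(1) ^ t] ways, it is requested with probability at most [q ^ t] for
    [q = O(n ^ (- (k - l) - 1 / (4 L)))].
    Then the Park-Pham argument applies: expose [p] in [log n] rounds. In each
    round replace a requested set by a smallest set of edges which still has to
    appear. Those which are not halved are covered, on average, by a family of
    cost [sum q ^ #|T| <= 4 q / p'], hence carry little of the measure. *)

Set Implicit Arguments.
Unset Strict Implicit.
Unset Printing Implicit Defensive.
Import Order.TTheory GRing.Theory Num.Theory.
Local Open Scope ring_scope.

(** * Binomial random subsets *)

Section BinomialSubset.
Variables (R : realFieldType) (X : finType).
Implicit Types (E G W T Z : {set X}) (p q : R) (f g : {set X} -> R).

Definition bweight E p G : R := \prod_(e in E) (if e \in G then p else 1 - p).

Definition bexp E p f : R := \sum_(G : {set X} | G \subset E) bweight E p G * f G.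

Lemma bweight_ge0 E p G : 0 <= p <= 1 -> 0 <= bweight E p G.
Proof.
by move=> /andP[p0 p1]; apply: prodr_ge0 => e _; case: ifP; rewrite ?subr_ge0.
Qed.

Lemma ler_bexp E p f g : 0 <= p <= 1 ->
  (forall G, G \subset E -> f G <= g G) -> bexp E p f <= bexp E p g.
Proof.
by move=> p01 fg; apply: ler_sum => G GE; rewrite ler_wpM2l ?bweight_ge0 ?fg.
Qed.

Lemma eq_bexp E p f g : (forall G, G \subset E -> f G = g G) ->
  bexp E p f = bexp E p g.
Proof. by move=> fg; apply: eq_bigr => G GE; rewrite fg. Qed.

Lemma bexpD E p f g : bexp E p (fun G => f G + g G) = bexp E p f + bexp E p g.
Proof. by rewrite -big_split; apply: eq_bigr => G _; rewrite mulrDr. Qed.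

Lemma bexpZr E p f (a : R) : bexp E p (fun G => f G * a) = bexp E p f * a.
Proof. by rewrite mulr_suml; apply: eq_bigr => G _; rewrite mulrA. Qed.

Lemma bexp0set p f : bexp set0 p f = f set0.
Proof.
rewrite /bexp (big_pred1 set0) => [|G]; last by rewrite subset0.
by rewrite /bweight big_set0 mul1r.
Qed.

(** Conditioning on whether [x] is chosen; this is the recursion behind the inductions on [#|E|]
    below. *)
Lemma bexpU1 E x p f : x \notin E ->
  bexp (x |: E) p f = p * bexp E p (fun G => f (x |: G)) + (1 - p) * bexp E p f.
Proof.
move=> xE; rewrite /bexp (bigID (fun G : {set X} => x \in G)) /=; congr (_ + _).
  rewrite (reindex_onto (fun G => x |: G) (fun G => G :\ x)) /=; last first.
    by move=> G /andP[_ xG]; rewrite setD1K.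
  rewrite mulr_sumr; apply: eq_big => [G|G /andP[_ /eqP GE]].
    apply/idP/idP => [/andP[/andP[/subsetP GE _] /eqP <-]|GE].
      apply/subsetP => y; rewrite !inE => /andP[yx]; rewrite (negPf yx) /= => yG.
      by move/(_ y): GE; rewrite !inE yG orbT (negPf yx) => /(_ isT).
    rewrite setUS // setU11 /=; apply/eqP; rewrite setU1K //.
    by apply: contra xE; apply/subsetP.
  rewrite mulrA; congr (_ * _).
  rewrite /bweight big_setU1 //= setU11; congr (_ * _).
  apply: eq_bigr => e eE; rewrite !inE; case: eqP => // ex.
  by rewrite -ex eE in xE.
rewrite mulr_sumr; apply: eq_big => [G|G /andP[GE xG]].
  apply/andP/idP => [[/subsetP GE xG]|GE].
    apply/subsetP => y yG; have := GE y yG; rewrite !inE; case: eqP => // yx.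
    by rewrite -yx yG in xG.
  split; first by apply: subset_trans GE _; rewrite subsetU1.
  by apply: contra xE; apply/subsetP.
by rewrite mulrA /bweight big_setU1 //= (negPf xG).
Qed.

(** Exposure in two rounds: an element is missed by the union exactly when both independent subsets
    miss it, which has probability [(1 - p1) * (1 - p2)]. *)
Lemma bexpU E p1 p2 f :
  bexp E p1 (fun G1 => bexp E p2 (fun G2 => f (G1 :|: G2))) =
  bexp E (p1 + p2 - p1 * p2) f.
Proof.
move: {2}#|E| (erefl #|E|) => n; elim: n E f => [|n IHn] E f.
  by move=> /eqP; rewrite cards_eq0 => /eqP->; rewrite !bexp0set setU0.
move=> cE; have /set0Pn[x xE] : E != set0 by rewrite -cards_eq0 cE.
have xE' : x \notin E :\ x by rewrite !inE eqxx.
have cE' : #|E :\ x| = n by move: cE; rewrite (cardsD1 x) xE; case.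
rewrite -(setD1K xE) !bexpU1 //.
set E' := E :\ x in xE' cE' *.
have -> : bexp E' p1 (fun G => bexp (x |: E') p2 (fun G2 => f (x |: G :|: G2))) =
    bexp E' (p1 + p2 - p1 * p2) (fun G => f (x |: G)).
  rewrite -IHn //; apply: eq_bexp => G _; rewrite bexpU1 //.
  rewrite [X in p2 * X](_ : _ = bexp E' p2 (fun G2 => f (x |: (G :|: G2)))).
    rewrite [X in (1 - p2) * X](_ : _ = bexp E' p2 (fun G2 => f (x |: (G :|: G2)))).
      by ring.
    by apply: eq_bexp => G2 _; rewrite setUA.
  by apply: eq_bexp => G2 _; congr f; rewrite setUACA setUid.
have -> : bexp E' p1 (fun G => bexp (x |: E') p2 (fun G2 => f (G :|: G2))) =
    bexp E' (p1 + p2 - p1 * p2) (fun G => f (x |: G)) * p2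
    + bexp E' (p1 + p2 - p1 * p2) f * (1 - p2).
  rewrite -!IHn // -!bexpZr -bexpD; apply: eq_bexp => G _; rewrite bexpU1 //.
  rewrite [X in p2 * X](_ : _ = bexp E' p2 (fun G2 => f (x |: (G :|: G2)))).
    by ring.
  by apply: eq_bexp => G2 _; rewrite setUCA.
by ring.
Qed.

Lemma bexp_cst E p (a : R) : bexp E p (fun=> a) = a.
Proof.
move: {2}#|E| (erefl #|E|) => n; elim: n E => [|n IHn] E.
  by move=> /eqP; rewrite cards_eq0 => /eqP->; rewrite bexp0set.
move=> cE; have /set0Pn[x xE] : E != set0 by rewrite -cards_eq0 cE.
have cE' : #|E :\ x| = n by move: cE; rewrite (cardsD1 x) xE; case.
rewrite -(setD1K xE) bexpU1 ?IHn // ?inE ?eqxx //; ring.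
Qed.

Lemma ler_bexp_mono E p1 p2 f : 0 <= p1 <= p2 -> p1 < 1 -> p2 <= 1 ->
  (forall G G', G \subset G' -> f G' <= f G) ->
  bexp E p2 f <= bexp E p1 f.
Proof.
move=> /andP[p10 p12] p11 p21 fmono.
(* A further independent round of density [s] raises the density from [p1] to [p2], and adding
   elements can only decrease [f]. *)
pose s := (p2 - p1) / (1 - p1).
have p1' : 0 < 1 - p1 by rewrite subr_gt0.
have s01 : 0 <= s <= 1.
  by rewrite /s ler_pdivrMr // divr_ge0 ?subr_ge0 //=; lra.
have -> : p2 = p1 + s - p1 * s.
  by rewrite /s; field; rewrite gt_eqF.
rewrite -bexpU; apply: ler_bexp => [|G GE]; first by rewrite p10 ltW.
rewrite -[leRHS](bexp_cst E s); apply: ler_bexp => // G2 _.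
by apply: fmono; rewrite subsetUl.
Qed.

(** On [T] each factor [1 - p] of the weight of [W] becomes [p]; the discarded factors are at most
    1. This trades a sum over [W] for one over [W :|: T]. *)
Lemma bweightU E p W T : 0 <= p <= 1 -> T \subset E -> [disjoint T & W] ->
  bweight E p W * p ^+ #|T| <= bweight E p (W :|: T).
Proof.
move=> p01 TE TW; have /andP[p0 p1] := p01.
have split_T (w : X -> R) :
    \prod_(e in E) w e = \prod_(e in T) w e * \prod_(e in E :\: T) w e.
  rewrite (big_setID T) /=; congr (_ * _).
  by apply: eq_bigl => e; rewrite (setIidPr TE).
rewrite /bweight !split_T.
have -> : \prod_(e in T) (if e \in W :|: T then p else 1 - p) = p ^+ #|T|.
  by rewrite -prodr_const; apply: eq_bigr => e eT; rewrite inE eT orbT.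
have -> : \prod_(e in E :\: T) (if e \in W :|: T then p else 1 - p) =
          \prod_(e in E :\: T) (if e \in W then p else 1 - p).
  by apply: eq_bigr => e; rewrite !inE => /andP[/negPf-> _]; rewrite orbF.
rewrite mulrAC [leRHS]mulrC mulrC; apply: ler_wpM2r; last first.
  rewrite -[leRHS]mul1r; apply: ler_wpM2r; first by rewrite exprn_ge0.
  apply: prodr_ile1 => e _; case: ifP => _; first by rewrite p0.
  by rewrite subr_ge0 p1 lerBlDr lerDl.
by apply: prodr_ge0 => e _; case: ifP; rewrite ?subr_ge0.
Qed.

End BinomialSubset.

(** * Spread measures *)

Section Fragments.
Variables (X : finType) (Om : finType) (A : {set Om}) (S : Om -> {set X}).
Implicit Types (W T Z : {set X}) (w : Om).

(** The minimum fragment of Park and Pham: the fewest elements still missing after [W], where [S w]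
    may be exchanged for any [S v] inside [S w :|: W]. *)
Definition fragment W w : {set X} :=
  S [arg min_(v < w | (v \in A) && (S v \subset S w :|: W)) #|S v :\: W|] :\: W.

Lemma fragmentP W w : w \in A ->
  exists v, [/\ v \in A, S v \subset S w :|: W, fragment W w = S v :\: W &
    forall u, u \in A -> S u \subset S w :|: W ->
      (#|fragment W w| <= #|S u :\: W|)%N].
Proof.
move=> wA; rewrite /fragment; case: arg_minnP => [|v /andP[vA vS] vmin].
  by rewrite wA subsetUl.
by exists v; split=> // u uA uS; apply: vmin; rewrite uA.
Qed.

Lemma fragment_sub W w : w \in A -> fragment W w \subset S w.
Proof.
move=> wA; have [v [_ vS -> _]] := fragmentP W wA.
by rewrite subDset setUC.
Qed.

(* A minimal fragment is recovered from the union Z = W :|: fragment W w up to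
   2 ^ #|S v| choices, where v only depends on Z. *)
Definition fragment_host Z : {set X} :=
  if [pick v in A | S v \subset Z] is Some v then S v else set0.

(** If [S u] lies in the union, it lies in [S w :|: W], so [S u :\: W] competes for the minimum
    while being contained in the fragment. Minimality forces equality, hence the fragment lies in
    [S u]. *)
Lemma fragment_sub_host W w : w \in A ->
  fragment W w \subset fragment_host (W :|: fragment W w).
Proof.
move=> wA; have [v [vA vS fE fmin]] := fragmentP W wA.
rewrite /fragment_host; case: pickP => [u /andP[uA uS]|/(_ v)]; last first.
  by rewrite vA fE -subDset subxx.
have uW : S u :\: W \subset fragment W w by rewrite subDset.
have uS' : S u \subset S w :|: W.
  by apply: subset_trans uS _; rewrite setUC setSU // fragment_sub.
have /eqP <- : S u :\: W == fragment W w by rewrite eqEcard uW fmin.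
exact: subsetDl.
Qed.

Lemma card_fragment_host_lt m Z : (0 < m)%N ->
  (forall w, w \in A -> (#|S w| < m)%N) -> (#|fragment_host Z| < m)%N.
Proof.
by move=> m0 Sm; rewrite /fragment_host; case: pickP => [v /andP[/Sm]|]; rewrite ?cards0.
Qed.

Lemma disjoint_fragment W w : w \in A -> [disjoint fragment W w & W].
Proof.
move=> wA; have [v [_ _ -> _]] := fragmentP W wA.
by rewrite -setI_eq0 setIDAC setDIl setDv setI0.
Qed.

Lemma fragment_cover W W' w : w \in A -> fragment W w \subset W' ->
  exists2 v, v \in A & S v \subset W :|: W'.
Proof.
move=> wA; have [v [vA _ -> _]] := fragmentP W wA => vW.
by exists v => //; rewrite -subDset.
Qed.

End Fragments.

Section Spread.
Variables (R : realFieldType) (X : finType) (E : {set X}).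
Variables (Om : finType) (mu : Om -> R) (mu_ge0 : forall w, 0 <= mu w).
Variables (p q : R) (p01 : 0 < p <= 1) (q0 : 0 <= q) (qp : 4 * q <= p).
Implicit Types (W T Z : {set X}) (A : {set Om}) (S : Om -> {set X}).

(** Instead of the pair [W], [T], count the pair [Z = W :|: T], [T], at the price of dividing by
    [p ^+ #|T|]. Given [Z], the set [T] is one of at most [4 ^ (2 ^ r)] subsets of the host, each of
    cost at most [(q / p) ^+ (2 ^ r)]. *)
Lemma cost_large_fragments A S r :
  (forall w, w \in A -> S w \subset E) ->
  (forall w, w \in A -> (#|S w| < 2 ^ r.+1)%N) ->
  bexp E p (fun W =>
    \sum_(T in [set fragment A S W w | w in A] | (2 ^ r <= #|T|)%N) q ^+ #|T|)
  <= 4 * q / p.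
Proof.
move=> SE Sr; have /andP[p0 p1] := p01.
have p01' : 0 <= p <= 1 by rewrite ltW.
have qp0 : 0 <= q / p by rewrite divr_ge0 // ltW.
have qp1 : 4 * q / p <= 1 by rewrite ler_pdivrMr // mul1r.
pose V Z := [set T : {set X} | (T \subset fragment_host A S Z) && (2 ^ r <= #|T|)%N].
pose U W := [set T in [set fragment A S W w | w in A] | (2 ^ r <= #|T|)%N].
have step : bexp E p (fun W => \sum_(T in U W) q ^+ #|T|) <=
    bexp E p (fun Z => \sum_(T in V Z) (q / p) ^+ #|T|).
  rewrite /bexp.
  under eq_bigr do rewrite mulr_sumr.
  under [leRHS]eq_bigr do rewrite mulr_sumr.
  rewrite (exchange_big_dep predT) //= [leRHS](exchange_big_dep predT) //=.
  apply: ler_sum => T _.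
  (* For fixed [T], these are the [W] that leave [T] as a large fragment. They are disjoint from
     [T], so [W :|: T] determines [W]. *)
  set P := (fun W : {set X} => (W \subset E) && (T \in U W)).
  have PT W : P W -> [/\ W \subset E, [disjoint T & W], T \subset E & T \in V (W :|: T)].
    move=> /andP[WE]; rewrite !inE => /andP[/imsetP[w wA TE] ->].
    rewrite TE disjoint_fragment // fragment_sub_host //; split=> //.
    exact: subset_trans (fragment_sub _ _ wA) (SE _ wA).
  have injU : {in [set W | P W] &, injective (fun W => W :|: T)}.
    move=> W W'; rewrite !inE => /PT[_ TW _ _] /PT[_ TW' _ _] /(congr1 (fun Z => Z :\: T)).
    rewrite !setDUl !setDv !setU0.
    by rewrite !(setDidPl _) // disjoint_sym.
  apply: (@le_trans _ _ (\sum_(W in [set W | P W]) bweight E p (W :|: T) * (q / p) ^+ #|T|)).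
    rewrite [leRHS](eq_bigl P); last by move=> W; rewrite inE.
    apply: ler_sum => W /PT[WE TW TE _].
    rewrite expr_div_n mulrA mulrAC; apply: ler_wpM2r; first by rewrite exprn_ge0.
    by rewrite ler_pdivlMr ?exprn_gt0 // bweightU.
  rewrite -(big_imset (fun Z => bweight E p Z * (q / p) ^+ #|T|) injU) /=.
  rewrite [leRHS]big_mkcond [leLHS]big_mkcond /=; apply: ler_sum => Z _.
  case: ifP => [/imsetP[W]|_]; last first.
    by case: ifP => // _; rewrite mulr_ge0 ?bweight_ge0 ?exprn_ge0.
  by rewrite inE => /PT[WE TW TE TV] ->; rewrite subUset WE TE TV.
rewrite (@eq_bexp _ _ _ _ _ (fun W => \sum_(T in U W) q ^+ #|T|)); last first.
  by move=> W _; apply: eq_bigl => T; rewrite inE.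
apply: (le_trans step); rewrite -[leRHS](bexp_cst E p); apply: ler_bexp => // Z _.
have r0 : (0 < 2 ^ r.+1)%N by rewrite expn_gt0.
have hostr := card_fragment_host_lt Z r0 Sr.
apply: (@le_trans _ _ (\sum_(T in powerset (fragment_host A S Z)) (q / p) ^+ (2 ^ r))).
  rewrite [leRHS]big_mkcond [leLHS]big_mkcond /=; apply: ler_sum => T _.
  rewrite !inE; case: (T \subset _) => //=; case: ifP => [Tr|_]; last by rewrite exprn_ge0.
  apply: ler_wiXn2l => //; apply: le_trans qp1; rewrite -mulrA.
  by rewrite ler_peMl // ler1n.
rewrite sumr_const card_powerset.
apply: (@le_trans _ _ ((4 * q / p) ^+ (2 ^ r))); last first.
  rewrite -[leRHS]expr1; apply: ler_wiXn2l; rewrite ?expn_gt0 //.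
  by rewrite divr_ge0 ?mulr_ge0 // ltW.
rewrite -mulrA [leRHS]exprMn -[leLHS]mulr_natl; apply: ler_wpM2r; first exact: exprn_ge0.
rewrite -natrX ler_nat (_ : 4 = 2 ^ 2)%N // -expnM -expnS leq_exp2l //.
exact: ltnW.
Qed.

(** Induction on the rounds: after a round the fragments replace the sets [S w]. Those below half
    the size bound continue, and the mass of the others is at most the cost of a family covering
    them. The mass of [A] is kept as a factor since [A] shrinks from round to round. *)
Theorem spread_missed r : forall A S,
  (forall w, w \in A -> S w \subset E) ->
  (forall w, w \in A -> (#|S w| < 2 ^ r)%N) ->
  (forall T, \sum_(w in A | T \subset S w) mu w <= q ^+ #|T|) ->
  bexp E (1 - (1 - p) ^+ r) (fun G => (~~ [exists w in A, S w \subset G])%:R)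
    * \sum_(w in A) mu w <= r%:R * (4 * q / p).
Proof.
have /andP[p0 p1] := p01; have p01' : 0 <= p <= 1 by rewrite ltW.
elim: r => [|r IHr] A S SE Sr spread.
  (* With no round left the sets have size below 1, so they are empty and never missed. *)
  rewrite mul0r; have [->|/set0Pn[w wA]] := eqVneq A set0.
    by rewrite big_set0 mulr0.
  rewrite (@eq_bexp _ _ _ _ _ (fun=> 0)) ?bexp_cst ?mul0r // => G _.
  case: existsP => // -[]; exists w; rewrite wA /=.
  by have := Sr w wA; rewrite expn0 ltnS leqn0 cards_eq0 => /eqP->; rewrite sub0set.
set pr := 1 - (1 - p) ^+ r.
have pr01 : 0 <= pr <= 1.
  rewrite /pr subr_ge0 exprn_ile1 ?subr_ge0 //=; last by rewrite lerBlDr lerDl ltW.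
  by rewrite lerBlDr lerDl exprn_ge0 // subr_ge0.
(* The first round has density [p]; the remaining [r] rounds together have density [pr]. *)
have -> : 1 - (1 - p) ^+ r.+1 = p + pr - p * pr by rewrite /pr exprS; ring.
rewrite -bexpU -bexpZr.
pose cost W := \sum_(T in [set fragment A S W w | w in A] | (2 ^ r <= #|T|)%N) q ^+ #|T|.
apply: (@le_trans _ _ (bexp E p (fun W => r%:R * (4 * q / p) + cost W))); last first.
  rewrite bexpD bexp_cst -[r.+1%:R]natr1 [leRHS]mulrDl mul1r lerD2l.
  exact: cost_large_fragments.
apply: ler_bexp => // W WE.
pose A' := [set w in A | (#|fragment A S W w| < 2 ^ r)%N].
rewrite (bigID (fun w => w \in A')) /= mulrDr; apply: lerD; last first.
  apply: (@le_trans _ _ (\sum_(w in A | w \notin A') mu w)).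
    rewrite -[leRHS]mul1r; apply: ler_wpM2r; first exact: sumr_ge0.
    rewrite -[leRHS](bexp_cst E pr); apply: ler_bexp => // G _.
    by case: (~~ _).
  (* Group the dropped [w] by their fragment [T]: since [T \subset S w], spreadness bounds each
     group by [q ^+ #|T|]. *)
  rewrite /cost (partition_big (fragment A S W)
     (fun T => (T \in [set fragment A S W w | w in A]) && (2 ^ r <= #|T|)%N)) /=.
    apply: ler_sum => T _; apply: le_trans (spread T).
    rewrite [leRHS]big_mkcond [leLHS]big_mkcond /=; apply: ler_sum => w _.
    case: ifP => [/andP[/andP[wA _] /eqP<-]|_]; first by rewrite wA fragment_sub.
    by case: ifP.
  move=> w /andP[wA]; rewrite inE wA /= -leqNgt => ->.
  by rewrite andbT imset_f.
have A'A w : w \in A' -> w \in A by rewrite inE => /andP[].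
have -> : \sum_(i in A | i \in A') mu i = \sum_(i in A') mu i.
  by apply: eq_bigl => w; rewrite !inE andbA andbb.
apply: le_trans (IHr A' (fragment A S W) _ _ _) => [|w wA'|w|T].
- apply: ler_wpM2r; first exact: sumr_ge0.
  (* A later [G] containing a fragment completes some [S v] inside [W :|: G], so missing every [S v]
     implies missing every fragment. *)
  apply: ler_bexp => // G _; rewrite ler_nat; case: existsP => // nA.
  case: existsP => // -[w /andP[wA' wG]]; case: nA.
  by have [v vA vS] := fragment_cover (A'A _ wA') wG; exists v; rewrite vA.
- by apply: subset_trans (fragment_sub _ _ (A'A _ wA')) (SE _ (A'A _ wA')).
- by rewrite inE => /andP[].
apply: le_trans (spread T).
rewrite [leRHS]big_mkcond [leLHS]big_mkcond /=; apply: ler_sum => w _.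
case: ifP => [/andP[/A'A wA Tw]|_]; last by case: ifP.
by rewrite wA (subset_trans Tw) // fragment_sub.
Qed.

End Spread.

(** * Random orderings with prescribed edges *)

Lemma leq_card_bigcup (I T : finType) (A : {set I}) (F : I -> {set T}) :
  (#|\bigcup_(i in A) F i| <= \sum_(i in A) #|F i|)%N.
Proof.
elim/big_rec2: _ => [|i y Y _ IH]; first by rewrite cards0.
by apply: leq_trans (leq_card_setU _ _) _; rewrite leq_add2l.
Qed.

Lemma ffact_leq_exp n k : (n ^_ k <= n ^ k)%N.
Proof.
elim: k n => [|k IHk] n //; rewrite ffactnS expnS leq_mul2l; apply/orP; right.
by apply: leq_trans (IHk _) _; case: k {IHk} => // k; rewrite leq_exp2r // leq_pred.
Qed.

Section ResampledPermutations.
Variable T : finType.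
Implicit Types (F A B J b e : {set T}) (x s : {perm T}) (Om : {set {perm T}}).

(** Products of permutations act from left to right, so [s * x] places at position [j] the vertex
    [x (s j)]: the vertices at the positions of [F] are permuted and all other positions keep
    theirs. *)
Definition resampling_closed F Om :=
  forall s x, perm_on F s -> x \in Om -> (s * x)%g \in Om.

Lemma perm_on_imset_eq F A B : A \subset F -> B \subset F -> #|A| = #|B| ->
  exists2 s, perm_on F s & s @: A = B.
Proof.
move: {2}#|A :\: B| (leqnn #|A :\: B|) => m; elim: m A => [|m IHm] A.
  rewrite leqn0 cards_eq0 setD_eq0 => AB AF BF cAB.
  exists 1%g; first exact: perm_on1.
  rewrite (eq_imset (g := id)) ?imset_id; last by move=> y; rewrite perm1.
  by apply/eqP; rewrite eqEcard AB cAB /=.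
move=> cm AF BF cAB.
have [AB0|/set0Pn[a]] := eqVneq (A :\: B) set0.
  by apply: IHm => //; rewrite AB0 cards0.
rewrite inE => /andP[aB aA].
have /set0Pn[c] : B :\: A != set0.
  rewrite setD_eq0; apply: contra aB => BA.
  by have /eqP -> : B == A; rewrite // eqEcard BA cAB /=.
rewrite inE => /andP[cA cB].
have cF : c \in F by apply: (subsetP BF).
have aF : a \in F by apply: (subsetP AF).
pose A' := tperm a c @: A.
have tF : perm_on F (tperm a c).
  apply/subsetP => y; rewrite inE; case: tpermP => [->|->|]; rewrite ?eqxx //.
have A'F : A' \subset F.
  apply/subsetP => _ /imsetP[y yA ->].
  by rewrite perm_closed // (subsetP AF).
have [||||s sF sA] := IHm A' => //.
- rewrite -ltnS; apply: leq_trans cm; apply: proper_card.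
  apply/properP; split.
    apply/subsetP => y; rewrite !inE => /andP[yB /imsetP[z zA yE]].
    rewrite yB /=; move: yE; case: tpermP => [_|zc|_ _ ->] // yE.
      by rewrite yE cB in yB.
    by rewrite -zc zA in cA.
  exists a; first by rewrite inE aB.
  rewrite inE aB /=; apply/imsetP => -[y yA].
  case: tpermP => [_ ac|yc|/eqP ya _ ay]; first by rewrite -ac aA in cA.
    by rewrite -yc yA in cA.
  by rewrite ay eqxx in ya.
- by rewrite card_imset //; apply: perm_inj.
exists (tperm a c * s)%g; first exact: perm_onM.
rewrite -sA /A' -imset_comp; apply: eq_imset => y /=; by rewrite permM.
Qed.

(** By transitivity every subset of [F] of size [#|b|] is the image of [b] under equally many
    permutations of [F], and these classes partition all of them. *)
Lemma card_perm_on_onto F b e : b \subset F -> e \subset F -> #|e| = #|b| ->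
  (#|[set s | perm_on F s & s @: b == e]| * 'C(#|F|, #|b|) = #|F|`!)%N.
Proof.
move=> bF eF ceb; pose N e := #|[set s | perm_on F s & s @: b == e]|.
have NE e' : e' \subset F -> #|e'| = #|b| -> N e' = N e.
  move=> e'F ce'; have [s sF se] : exists2 s, perm_on F s & s @: e' = e.
    by apply: perm_on_imset_eq => //; rewrite ce'.
  rewrite /N; have -> : [set u | perm_on F u & u @: b == e] =
      (fun u : {perm T} => (u * s)%g) @: [set u | perm_on F u & u @: b == e'].
    apply/setP => u; rewrite !inE; apply/andP/imsetP => [[uF /eqP ub]|].
      exists (u * s^-1)%g; last by rewrite mulgKV.
      rewrite inE perm_onM // ?perm_onV //=; apply/eqP.
      have -> : e' = s^-1%g @: e.
        by rewrite -se -imset_comp (eq_imset (g := id)) ?imset_id // => y; rewrite /= permK.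
      by rewrite -ub -imset_comp; apply: eq_imset => y; rewrite /= permM.
    move=> [v]; rewrite inE => /andP[vF /eqP vb] ->; split; first exact: perm_onM.
    by rewrite -se -vb -imset_comp; apply/eqP/eq_imset => y; rewrite /= permM.
  by rewrite card_imset //; apply: mulIg.
rewrite -/(N e) -card_perm -(cards_draws F #|b|).
rewrite mulnC -sum_nat_const.
rewrite -[RHS]sum1_card.
rewrite (partition_big (fun s : {perm T} => s @: b)
  (fun e' => e' \in [set B : {set T} | B \subset F & #|B| == #|b|])) /=.
  apply: eq_bigr => e'; rewrite inE => /andP[e'F /eqP ce'].
  by rewrite -(NE e') // sum1dep_card; congr #|pred_of_set _|; apply/setP => s; rewrite !inE.
move=> s sF; rewrite inE card_imset ?eqxx ?andbT; last exact: perm_inj.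
by apply/subsetP => _ /imsetP[y yb ->]; rewrite perm_closed // (subsetP bF).
Qed.

(** Each fixed [s] maps [Om] bijectively to itself, so resampling [F] preserves the uniform measure
    on [Om]. *)
Lemma resample_sum F Om (P : pred {perm T}) : resampling_closed F Om ->
  (\sum_(x in Om) \sum_(s | perm_on F s) P (s * x)%g =
   #|F|`! * #|[set x in Om | P x]|)%N.
Proof.
move=> OmF; rewrite exchange_big /= -card_perm -sum_nat_const.
apply: eq_bigr => s sF.
rewrite (reindex_inj (mulgI s^-1%g)) /=.
rewrite -sum1dep_card big_mkcondr /=; apply: eq_big => [x|x _]; last first.
  by rewrite mulKVg; case: (P x).
apply/idP/idP => xO; last by apply: OmF => //; rewrite perm_onV.
by rewrite -(mulKVg s x); apply: OmF.
Qed.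

(** Resample [F] at a fixed [x]: the image of [b] becomes a uniform subset of [x @: F] of its size,
    and it hits one of the at least [M] available edges with probability at least
    [M / 'C(#|F|, #|b|)]. *)
Lemma card_block_in F Om b (H : {set {set T}}) M : resampling_closed F Om ->
  b \subset F -> (forall e, e \in H -> #|e| = #|b|) ->
  (forall x, x \in Om -> M <= #|[set e in H | e \subset x @: F]|)%N ->
  (#|Om| * M <= #|[set x in Om | x @: b \in H]| * 'C(#|F|, #|b|))%N.
Proof.
move=> OmF bF cH HM; pose N := #|[set s : {perm T} | perm_on F s & s @: b == b]|.
have NC : (N * 'C(#|F|, #|b|) = #|F|`!)%N by exact: card_perm_on_onto.
have N0 : (0 < N)%N.
  apply/card_gt0P; exists 1%g; rewrite inE perm_on1 /=.
  by rewrite (eq_imset (g := id)) ?imset_id // => y; rewrite perm1.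
rewrite -(leq_pmul2l N0) [leqRHS]mulnCA mulnC.
have -> : (#|[set x in Om | x @: b \in H]| * (N * 'C(#|F|, #|b|)) =
   \sum_(x in Om) \sum_(s : {perm T} | perm_on F s) ((s * x)%g @: b \in H))%N.
  by rewrite (resample_sum (fun x : {perm T} => x @: b \in H)) // NC mulnC.
rewrite -mulnA -sum_nat_const; apply: leq_sum => x xO.
apply: (@leq_trans (\sum_(e in [set e in H | e \subset x @: F]) N)).
  by rewrite sum_nat_const leq_mul2r HM ?orbT.
apply: (@leq_trans (\sum_(e in [set e in H | e \subset x @: F])
   \sum_(s : {perm T} | perm_on F s) ((s * x)%g @: b == e))).
  apply: leq_sum => e; rewrite inE => /andP[eH eF].
  have xVF : x^-1%g @: e \subset F.
    apply/subsetP => _ /imsetP[y /(subsetP eF)/imsetP[z zF ->] ->].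
    by rewrite permK.
  have cV : #|x^-1%g @: e| = #|b| by rewrite card_imset ?cH //; apply: perm_inj.
  have NV := card_perm_on_onto bF xVF cV.
  have C0 : (0 < 'C(#|F|, #|b|))%N by rewrite bin_gt0 subset_leq_card.
  have -> : N = #|[set s : {perm T} | perm_on F s & s @: b == x^-1%g @: e]|.
    by apply/eqP; rewrite -(eqn_pmul2r C0) NV NC.
  rewrite -sum1dep_card big_mkcondr /=; apply: leq_sum => s sF.
  case: eqP => // sb; suff -> : (s * x)%g @: b = e by rewrite eqxx.
  transitivity (x @: (s @: b)).
    by rewrite -imset_comp; apply: eq_imset => y; rewrite /= permM.
  by rewrite sb -imset_comp (eq_imset (g := id)) ?imset_id // => y; rewrite /= permKV.
rewrite exchange_big /=; apply: leq_sum => s sF.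
have [sH|sH] := boolP ((s * x)%g @: b \in H).
  rewrite (leq_trans (n := \sum_(e : {set T}) ((s * x)%g @: b == e))) //.
    by rewrite [leqLHS]big_mkcond /=; apply: leq_sum => e _; case: ifP.
  rewrite (bigD1 ((s * x)%g @: b)) //= eqxx big1 // => e.
  by rewrite eq_sym => /negPf->.
rewrite big1 // => e; rewrite inE => /andP[eH _]; case: eqP => // E.
by rewrite E eH in sH.
Qed.

(** For fixed [x], the permutations [s] of [F] realising the prescribed values agree on [J]; divided
    by one of them, they fix [J] and permute [F :\: J]. *)
Lemma card_prescribed F Om J x0 : resampling_closed F Om -> J \subset F ->
  (#|[set x in Om | [forall j in J, x j == x0 j]]| * #|F|`!
    <= #|Om| * (#|F| - #|J|)`!)%N.
Proof.
move=> OmF JF; rewrite mulnC -(resample_sum (fun x => [forall j in J, x j == x0 j])) //.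
rewrite -sum_nat_const; apply: leq_sum => x xO.
pose P s := [forall j in J, (s * x)%g j == x0 j].
rewrite -big_mkcondr sum1dep_card.
have [->|/set0Pn[s0]] := eqVneq [set s | perm_on F s & P s] set0.
  by rewrite cards0.
rewrite inE => /andP[s0F /forall_inP s0P].
have -> : (#|F| - #|J| = #|F :\: J|)%N by rewrite cardsD (setIidPr JF).
rewrite -card_perm -(card_imset _ (mulIg s0^-1%g)).
apply: subset_leq_card; apply/subsetP => u /imsetP[s]; rewrite inE.
move=> /andP[sF /forall_inP sP] ->; rewrite unfold_in; apply/subsetP => y.
rewrite !inE => ny; apply/andP; split; last first.
  by apply: (subsetP (perm_onM sF (perm_onV s0F))); rewrite inE.
apply: contra ny => yJ; rewrite permM.
have := sP y yJ; rewrite -(eqP (s0P y yJ)) !permM => /eqP/perm_inj->.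
by rewrite permK.
Qed.

End ResampledPermutations.

(** * Vertex spread of the orderings whose blocks are edges of [H] *)

Section VertexSpread.
Variables (T : finType) (k m : nat) (H : {set {set T}}) (b : 'I_m -> {set T}).
Hypothesis Hk : forall e, e \in H -> #|e| = k.
Hypothesis bk : forall i, #|b i| = k.
Hypothesis b_disj : forall i j, i != j -> [disjoint b i & b j].

(** [B] collects the blocks released from their constraint: [set0] imposes all constraints and
    [setT] none. *)
Definition block_free (B : {set 'I_m}) : {set T} := ~: \bigcup_(i in ~: B) b i.

Definition block_perms (B : {set 'I_m}) : {set {perm T}} :=
  [set x : {perm T} | [forall i in ~: B, x @: b i \in H]].

Lemma block_perms_resampling B : resampling_closed (block_free B) (block_perms B).
Proof.
move=> s x sF; rewrite !inE => /forall_inP xB; apply/forall_inP => i iB.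
have -> : (s * x)%g @: b i = x @: b i; last exact: xB.
apply: eq_in_imset => y yb; rewrite permM (out_perm sF) //.
by rewrite inE negbK; apply/bigcupP; exists i.
Qed.

Lemma card_block_freeC B : (#|~: block_free B| <= m * k)%N.
Proof.
rewrite setCK; apply: leq_trans (leq_card_bigcup _ _) _.
rewrite (eq_bigr (fun=> k)) // sum_nat_const leq_mul2r.
by rewrite -[X in (_ <= X)%N](card_ord m) max_card orbT.
Qed.

Lemma card_edges_at (v : T) :
  (0 < k)%N -> (#|[set e in H | v \in e]| <= #|T| ^ k.-1)%N.
Proof.
move=> k0; have -> : (#|T| ^ k.-1 = #|{: k.-1.-tuple T}|)%N by rewrite card_tuple.
pose f (e : {set T}) : k.-1.-tuple T := [tuple nth v (enum (e :\ v)) i | i < k.-1].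
rewrite -(@card_in_imset _ _ f) ?max_card // => e e'.
rewrite !inE => /andP[eH ve] /andP[e'H ve'] /(congr1 val) /= ff.
have enumE (e1 : {set T}) : e1 \in H -> v \in e1 -> val (f e1) = enum (e1 :\ v).
  move=> e1H ve1; have c1 : size (enum (e1 :\ v)) = k.-1.
    by rewrite -cardE; have := cardsD1 v e1; rewrite ve1 (Hk e1H) => ->.
  apply: (@eq_from_nth _ v); first by rewrite size_tuple.
  move=> i; rewrite size_tuple => ik.
  by rewrite -[i]/(val (Ordinal ik)) -tnth_nth tnth_mktuple.
have := enumE e eH ve; have := enumE e' e'H ve'; rewrite /= ff => -> EE.
rewrite -(setD1K ve) -(setD1K ve'); congr (_ |: _).
by apply/setP => y; rewrite -!(mem_enum (pred_of_set (_ :\ _))) EE.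
Qed.

Variables (R : realFieldType) (eps : R).
Hypotheses (k0 : (0 < k)%N) (eps0 : 0 < eps) (T0 : (0 < #|T|)%N).
Hypothesis H_dense : eps * #|T|%:R ^+ k <= #|H|%:R.
Hypothesis mk_small : (m * k)%:R <= eps / 2 * #|T|%:R.

(** The at most [m * k] vertices outside [A] meet at most [m * k * #|T| ^ k.-1] edges, which by
    [mk_small] is at most half of the guaranteed edges. *)
Lemma card_edges_in (A : {set T}) : (#|~: A| <= m * k)%N ->
  eps / 2 * #|T|%:R ^+ k <= #|[set e in H | e \subset A]|%:R.
Proof.
move=> cA; have cH : (#|H| <= #|[set e in H | e \subset A]| + m * k * #|T| ^ k.-1)%N.
  rewrite -(cardsID [set e : {set T} | e \subset A] H); apply: leq_add.
    by apply: subset_leq_card; apply/subsetP => e; rewrite !inE.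
  apply: (@leq_trans #|\bigcup_(v in ~: A) [set e in H | v \in e]|).
    apply: subset_leq_card; apply/subsetP => e; rewrite !inE => /andP[eA eH].
    have /subsetPn[v ve vA] := eA.
    by apply/bigcupP; exists v; rewrite !inE ?eH.
  apply: leq_trans (leq_card_bigcup _ _) _.
  apply: (@leq_trans (\sum_(v in ~: A) #|T| ^ k.-1)).
    by apply: leq_sum => v _; apply: card_edges_at.
  by rewrite sum_nat_const leq_mul2r cA orbT.
move: cH; rewrite -(ler_nat R) natrD natrM => cH.
have Tk : #|T|%:R ^+ k = #|T|%:R * (#|T| ^ k.-1)%:R :> R.
  by rewrite natrX -exprS prednK.
have := ler_wpM2r (ler0n R (#|T| ^ k.-1)) mk_small.
move: H_dense; rewrite Tk; lra.
Qed.

(** The free positions carry all but at most [m * k] vertices, hence at least [eps / 2 * #|T| ^ k]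
    edges, out of at most [#|T| ^ k] images that the block can take under resampling. *)
Lemma card_block_perms_step (B : {set 'I_m}) i : i \in B ->
  eps / 2 * #|block_perms B|%:R <= #|block_perms (B :\ i)|%:R.
Proof.
move=> iB; set F := block_free B.
have bF : b i \subset F.
  apply/subsetP => y yb; rewrite inE; apply/bigcupP => -[j]; rewrite inE => jB yj.
  have ij : i != j by apply: contraNneq jB => <-.
  by have /pred0P/(_ y) := b_disj ij; rewrite /= yb yj.
have [->|/set0Pn[x0 x0B]] := eqVneq (block_perms B) set0.
  by rewrite cards0 mulr0.
pose M (x : {perm T}) := #|[set e in H | e \subset x @: F]|.
case: (arg_minnP M x0B) => x xB xmin.
have := card_block_in (@block_perms_resampling B) bF _ xmin.
rewrite bk => /(_ Hk).
have -> : [set y in block_perms B | y @: b i \in H] = block_perms (B :\ i).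
  apply/setP => y; rewrite !inE; apply/andP/forall_inP => [[/forall_inP yB yi] j|yB].
    by rewrite !inE negb_and negbK => /orP[/eqP->|jB] //; apply: yB; rewrite inE.
  split; last by apply: yB; rewrite !inE eqxx.
  by apply/forall_inP => j jB; apply: yB; move: jB; rewrite !inE => /negPf->; rewrite andbF.
rewrite -(ler_nat R) !natrM => le1.
have le2 : eps / 2 * #|T|%:R ^+ k <= (M x)%:R.
  apply: card_edges_in; apply: leq_trans (card_block_freeC B).
  rewrite [X in (_ <= X)%N]cardsCs setCK [X in (X <= _)%N]cardsCs setCK.
  by rewrite card_imset //; apply: perm_inj.
have le3 : 'C(#|F|, k)%:R <= #|T|%:R ^+ k :> R.
  rewrite -natrX ler_nat; apply: leq_trans (_ : #|F| ^ k <= _)%N; last first.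
    by rewrite leq_exp2r // max_card.
  apply: leq_trans (ffact_leq_exp _ _); rewrite -bin_ffact leq_pmulr //.
  exact: fact_gt0.
have Tk : 0 < #|T|%:R ^+ k :> R by rewrite exprn_gt0 // ltr0n.
rewrite -(ler_pM2r Tk).
have le4 := ler_wpM2l (ler0n R #|block_perms (B :\ i)|) le3.
have le5 := ler_wpM2l (ler0n R #|block_perms B|) le2.
apply: le_trans (le_trans le1 le4); apply: le_trans le5.
by rewrite mulrA [X in _ <= X * _]mulrC.
Qed.

Lemma card_block_perms_ge (B : {set 'I_m}) :
  (eps / 2) ^+ #|B| * #|block_perms B|%:R <= #|block_perms set0|%:R.
Proof.
move: {2}#|B| (erefl #|B|) => s; elim: s B => [|s IHs] B.
  by move/eqP; rewrite cards_eq0 => /eqP->; rewrite cards0 mul1r.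
move=> cB; have /set0Pn[i iB] : B != set0 by rewrite -cards_eq0 cB.
have cB' : #|B :\ i| = s by move: cB; rewrite (cardsD1 i) iB; case.
apply: le_trans (IHs _ cB'); rewrite cB cB' exprSr -mulrA.
by rewrite ler_pM2l ?exprn_gt0 ?divr_gt0 // card_block_perms_step.
Qed.

Lemma block_perms_gt0 : (0 < #|block_perms set0|)%N.
Proof.
rewrite -(ltr0n R); apply: lt_le_trans (card_block_perms_ge setT).
rewrite mulr_gt0 ?exprn_gt0 ?divr_gt0 // ltr0n; apply/card_gt0P; exists 1%g.
by rewrite inE; apply/forall_inP => i; rewrite !inE.
Qed.

(* Only the blocks met by [J] matter: releasing their constraint costs a factor
   [2 / eps] each, and then the released positions are uniformly permuted. *)
Lemma vertex_spread (c : R) (J : {set T}) (x0 : {perm T}) :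
  eps <= 1 -> (2 * m * k <= #|T|)%N ->
  (forall F v : nat, (v <= F)%N -> F%:R ^+ v * (F - v)`!%:R <= c ^+ v * F`!%:R) ->
  #|[set x in block_perms set0 | [forall j in J, x j == x0 j]]|%:R * #|T|%:R ^+ #|J|
   <= (4 * c / eps) ^+ #|J| * #|block_perms set0|%:R.
Proof.
move=> eps1 mkT cE; pose B := [set i | ~~ [disjoint b i & J]].
pose P B := #|block_perms B|%:R : R.
set F := block_free B.
have JF : J \subset F.
  apply/subsetP => j jJ; rewrite inE; apply/bigcupP => -[i].
  rewrite !inE negbK => /pred0P/(_ j) /=; rewrite jJ andbT => -> //.
(* The blocks are disjoint, so those meeting [J] have distinct representatives in [J]. *)
have BJ : (#|B| <= #|J|)%N.
  pose f i : option T := [pick j in b i :&: J].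
  have fP i : i \in B -> exists2 j, f i = Some j & j \in b i :&: J.
    rewrite inE /f -setI_eq0 => /set0Pn[j jb].
    by case: pickP => [j' j'b|/(_ j)]; [exists j' | rewrite jb].
  rewrite -(@card_in_imset _ _ f); last first.
    move=> i j /fP[y fi yi] /fP[z fj zj]; rewrite fi fj => -[yz].
    apply/eqP; apply: contraT => /b_disj/pred0P/(_ y) /=.
    by move: yi zj; rewrite yz !inE => /andP[-> _] /andP[->].
  have SomeI : injective (@Some T) by move=> ? ? [].
  rewrite -(card_imset J SomeI); apply: subset_leq_card.
  apply/subsetP => _ /imsetP[i /fP[j -> jb] ->]; apply: imset_f.
  by move: jb; rewrite inE => /andP[].
have TF : (#|T| <= 2 * #|F|)%N.
  by have := card_block_freeC B; have := cardsC F; rewrite -/F; lia.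
set a := #|_|; pose a1 := #|[set x in block_perms B | [forall j in J, x j == x0 j]]|.
have aa1 : (a <= a1)%N.
  apply: subset_leq_card; apply/subsetP => x; rewrite !inE => /andP[/forall_inP xO ->].
  by rewrite andbT; apply/forall_inP => i iB; apply: xO; rewrite !inE.
have := card_prescribed x0 (@block_perms_resampling B) JF.
rewrite -/a1 -/F -(ler_nat R) !natrM => pre.
have PB : P B <= (2 / eps) ^+ #|J| * P set0.
  apply: le_trans (_ : (2 / eps) ^+ #|B| * P set0 <= _); last first.
    rewrite ler_wpM2r ?ler0n // ler_weXn2l // ler_pdivlMr // mul1r.
    by apply: le_trans eps1 _; rewrite ler1n.
  have := card_block_perms_ge B; rewrite -/(P B) -/(P set0) => PB.
  have -> : P B = (2 / eps) ^+ #|B| * ((eps / 2) ^+ #|B| * P B).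
    have e1 : 2 / eps * (eps / 2) = 1 by field; rewrite gt_eqF.
    by rewrite mulrA -exprMn e1 expr1n mul1r.
  by rewrite ler_pM2l // exprn_gt0 // divr_gt0.
have c0 : 0 <= c by have := cE 1%N 1%N isT; rewrite !expr1 !mulr1; apply: le_trans.
have F0 : 0 < #|F|`!%:R :> R by rewrite ltr0n fact_gt0.
have cF := cE #|F| #|J| (subset_leq_card JF).
have TFJ : #|T|%:R ^+ #|J| <= 2 ^+ #|J| * #|F|%:R ^+ #|J| :> R.
  by rewrite -exprMn lerXn2r ?nnegrE ?mulr_ge0 ?ler0n // -natrM ler_nat.
rewrite -(ler_pM2r F0) mulrAC.
apply: le_trans (_ : (P B * (#|F| - #|J|)`!%:R) * (2 ^+ #|J| * #|F|%:R ^+ #|J|) <= _).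
  apply: ler_pM => //; rewrite ?mulr_ge0 ?exprn_ge0 ?ler0n //.
  by apply: le_trans pre; rewrite ler_pM2r // ler_nat.
have -> : P B * (#|F| - #|J|)`!%:R * (2 ^+ #|J| * #|F|%:R ^+ #|J|) =
    2 ^+ #|J| * (P B * (#|F|%:R ^+ #|J| * (#|F| - #|J|)`!%:R)) by ring.
(* The constant is a product: 2 from [#|T| <= 2 * #|F|], [2 / eps] from the released blocks, and [c]
   from the ratio of factorials. *)
have -> : (4 * c / eps) ^+ #|J| * #|block_perms set0|%:R * #|F|`!%:R =
    2 ^+ #|J| * (((2 / eps) ^+ #|J| * P set0) * (c ^+ #|J| * #|F|`!%:R)).
  have -> : 4 * c / eps = 2 * (2 / eps) * c by field; rewrite gt_eqF.
  by rewrite !exprMn /P; ring.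
rewrite ler_pM2l ?exprn_gt0 //; apply: ler_pM => //.
by rewrite mulr_ge0 ?exprn_ge0 ?ler0n.
Qed.

End VertexSpread.

(** * Patterns of edges on the cycle *)

Local Open Scope nat_scope.

Lemma cardsU_disjoint (T : finType) (A B : {set T}) : [disjoint A & B] ->
  #|A :|: B| = #|A| + #|B|.
Proof. by move=> /disjoint_setI0 AB; rewrite cardsU AB cards0 subn0. Qed.

(* Positions are the residues mod [d * N]; the slot [i] is the set of the [k]
   consecutive positions starting at [d * i], hence there are [N] slots. *)
Section Slots.
Variables (d k N L : nat).
Hypotheses (d0 : 0 < d) (dk : d + 2 <= k) (N0 : 0 < N) (kN : k <= d * N).
Let n := d * N.
Let n0 : 0 < n. Proof. by rewrite muln_gt0 d0. Qed.

Definition slot (i : nat) : {set 'I_n} :=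
  [set j : 'I_n | [exists c : 'I_k, j == (d * i + c) %% n :> nat]].

Definition posn (y : nat) : 'I_n := Ordinal (ltn_pmod y n0).

Lemma slotP i (j : 'I_n) :
  reflect (exists c : 'I_k, j = posn (d * i + c)) (j \in slot i).
Proof.
rewrite inE; apply: (iffP existsP) => -[c]; first by move/eqP=> jE; exists c; apply: val_inj.
by move=> ->; exists c.
Qed.

Lemma posn_slot i c : c < k -> posn (d * i + c) \in slot i.
Proof. by move=> ck; apply/slotP; exists (Ordinal ck). Qed.

Lemma posn_cell y : posn y %/ d = (y %/ d) %% N.
Proof. by rewrite /= /n mulnC modn_divl. Qed.

Lemma posn_mod y : posn y = y %[mod d].
Proof. by rewrite /= modn_dvdm // dvdn_mulr. Qed.

Lemma posn_inj c y z : y < N -> z < N -> posn (d * y + c) = posn (d * z + c) -> y = z.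
Proof.
move=> yN zN /(congr1 val) /= /eqP; rewrite eqn_modDr !modn_small ?ltn_pmul2l //.
by rewrite eqn_pmul2l // => /eqP.
Qed.

Lemma posn_mulmod y : posn (d * (y %% N)) = posn (d * y).
Proof. by apply: val_inj => /=; rewrite muln_modr modn_mod. Qed.

Lemma card_slot i : #|slot i| = k.
Proof.
have -> : slot i = [set posn (d * i + c) | c : 'I_k].
  apply/setP => j; apply/slotP/imsetP => [[c ->]|[c _ ->]]; first by exists c.
  by exists c.
rewrite card_imset ?card_ord // => c c' /(congr1 val) /= /eqP.
rewrite eqn_modDl !modn_small => [/eqP/val_inj//||].
  exact: leq_trans (ltn_ord _) kN.
exact: leq_trans (ltn_ord _) kN.
Qed.

(** The slots left to [H]. Stopping at [N %/ L * L] leaves at least [L] steps from the last of them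
    to the return to slot 0, so that for [k <= L] it does not overlap the first one. *)
Definition hslot (i : nat) : bool := (L %| i) && (i < N %/ L * L).

(** Consecutive multiples of [L] are [L] apart, but the gap around the origin can reach nearly
    [2 * L]. *)
Lemma hslot_near y : 0 < L <= N -> exists j, 0 < j <= 2 * L /\ hslot ((y + j) %% N).
Proof.
move=> /andP[L0 LN]; wlog yN : y / y < N => [hw|].
  have [j [j0 jh]] := hw (y %% N) (ltn_pmod _ N0); exists j; split=> //.
  by rewrite -modnDml.
have NL : 0 < N %/ L by rewrite divn_gt0.
have NE := divn_eq N L; have NL' := ltn_pmod N L0.
have yE := divn_eq y L; have yL' := ltn_pmod y L0.
have [yl|yl] := ltnP ((y %/ L).+1) (N %/ L).
  exists (L - y %% L); split; first lia.
  have -> : y + (L - y %% L) = (y %/ L).+1 * L by rewrite mulSn; lia.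
  have lt1 : (y %/ L).+1 * L < N %/ L * L by rewrite ltn_pmul2r.
  by rewrite modn_small ?/hslot ?dvdn_mull ?lt1 //; lia.
have le1 : (N %/ L) * L <= (y %/ L).+1 * L by rewrite leq_mul2r yl orbT.
exists (N - y); split; first by move: le1; rewrite mulSn; lia.
by rewrite subnKC ?modnn 1?ltnW // /hslot dvdn0 muln_gt0 NL.
Qed.

Section Pattern.
Variables (V : finType) (I : {set V}) (tau : V -> 'I_N).
Hypothesis tau_inj : {in I &, injective tau}.
Hypothesis I0 : I != set0.

Definition occupied y : bool := [exists e in I, tau e == y %% N :> nat].

Lemma occupiedP y : reflect (exists2 e, e \in I & val (tau e) = y %% N) (occupied y).
Proof.
apply: (iffP existsP) => [[e /andP[eI /eqP eE]]|[e eI eE]]; exists e => //.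
by rewrite eI eE eqxx.
Qed.

Lemma occupied_mod y : occupied (y %% N) = occupied y.
Proof. by rewrite /occupied modn_mod. Qed.

Lemma occupied_modDl y z : occupied (y %% N + z) = occupied (y + z).
Proof. by rewrite /occupied modnDml. Qed.

Lemma occupied_tau e : e \in I -> occupied (tau e).
Proof. by move=> eI; apply/occupiedP; exists e => //; rewrite modn_small. Qed.

Definition run_ends : {set V} := [set e in I | ~~ occupied (tau e + 1)].

(* [d * j < k] says that the slots [y] and [y + j] overlap. *)
Definition comp_ends : {set V} :=
  [set e in I | [forall j : 'I_k, (0 < j) && (d * j < k) ==> ~~ occupied (tau e + j)]].

Lemma comp_endsP e j : e \in comp_ends -> 0 < j -> d * j < k -> ~~ occupied (tau e + j).
Proof.
rewrite inE => /andP[_ /forallP eB] j0 jk.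
have jk' : j < k by apply: leq_ltn_trans jk; rewrite leq_pmull.
by have := eB (Ordinal jk'); rewrite /= j0 jk.
Qed.

Lemma not_comp_ends e : e \in I -> e \notin comp_ends ->
  exists j, [/\ 0 < j, d * j < k, occupied (tau e + j) &
    forall i, 0 < i -> occupied (tau e + i) -> j <= i].
Proof.
move=> eI; rewrite inE eI /= negb_forall => /existsP[j0].
rewrite negb_imply negbK => /andP[/andP[j00 j0k] j0D].
have ex : exists j, (0 < j) && occupied (tau e + j) by exists j0; rewrite j00.
case: (ex_minnP ex) => j /andP[jp jD] jmin; exists j; split=> //.
  by apply: leq_ltn_trans j0k; rewrite leq_pmul2l // jmin // j00.
by move=> i i0 iD; apply: jmin; rewrite i0.
Qed.

(** Three disjoint sets of covered positions: the first [d] of every slot, the start of the next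
    cell for every run end, and the last position of the slot of every component end. The first ones
    lie in occupied cells (blocks of [d] positions), the others in unoccupied ones. *)
Lemma card_cover_slots_ge :
  d * #|I| + #|run_ends| + #|comp_ends| <= #|\bigcup_(e in I) slot (tau e)|.
Proof.
pose f1 (u : V * 'I_d) := posn (d * tau u.1 + u.2).
pose P1 := f1 @: setX I setT.
pose P2 := [set posn (d * (tau e + 1)) | e in run_ends].
pose P3 := [set posn (d * tau e + k.-1) | e in comp_ends].
have EI e : e \in run_ends -> e \in I by rewrite inE => /andP[].
have BI e : e \in comp_ends -> e \in I by rewrite inE => /andP[].
have cP1 : #|P1| = d * #|I|.
  rewrite card_in_imset ?cardsX ?cardsT ?card_ord 1?mulnC //.
  move=> [e a] [e' a'] /setXP[/= eI _] /setXP[/= e'I _]; rewrite /f1 /= => E.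
  have := congr1 (fun j : 'I_n => (j %/ d, j %% d)) E; rewrite !posn_cell !posn_mod.
  rewrite ![d * _]mulnC !divnMDl // !modnMDl !divn_small ?ltn_ord // !addn0.
  rewrite !(modn_small (ltn_ord _)) => -[/val_inj te /val_inj ->].
  by rewrite (tau_inj eI e'I te).
have cP2 : #|P2| = #|run_ends|.
  rewrite card_in_imset // => e e' /EI eI /EI e'I; rewrite !mulnDr => /posn_inj te.
  by apply: tau_inj => //; apply: val_inj; apply: te.
have cP3 : #|P3| = #|comp_ends|.
  rewrite card_in_imset // => e e' /BI eI /BI e'I /posn_inj te.
  by apply: tau_inj => //; apply: val_inj; apply: te.
have D1 j : j \in P1 -> occupied (j %/ d).
  move=> /imsetP[[e a] /setXP[/= eI _] ->]; rewrite posn_cell occupied_mod.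
  by rewrite /= [d * _]mulnC divnMDl // divn_small // addn0 occupied_tau.
have D2 j : j \in P2 -> ~~ occupied (j %/ d).
  move=> /imsetP[e eE ->]; rewrite posn_cell occupied_mod mulKn //.
  by move: eE; rewrite inE => /andP[].
have kd0 : 0 < k.-1 %/ d by rewrite divn_gt0 //; lia.
have kdk : d * (k.-1 %/ d) < k.
  by rewrite mulnC (leq_ltn_trans (leq_divM _ _)) // prednK //; lia.
have D3 j : j \in P3 -> ~~ occupied (j %/ d).
  move=> /imsetP[e eB ->]; rewrite posn_cell occupied_mod [d * _]mulnC divnMDl //.
  exact: comp_endsP.
have d12 : [disjoint P1 & P2].
  by apply/pred0P => j /=; apply/negP => /andP[/D1 jD /D2]; rewrite jD.
have d13 : [disjoint P1 & P3].
  by apply/pred0P => j /=; apply/negP => /andP[/D1 jD /D3]; rewrite jD.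
(* A common position makes [d] divide [k.-1], with quotient at least 2 because [d + 2 <= k]. The
   slot of the run end would then be ahead of the slot of the component end and overlap it. *)
have d23 : [disjoint P2 & P3].
  apply/pred0P => j /=; apply/negP => /andP[/imsetP[e' e'E jE] /imsetP[e eB jE']].
  have := congr1 (fun j : 'I_n => (j %/ d, j %% d)) (etrans (esym jE) jE').
  rewrite !posn_cell !posn_mod mulKn // modnMr [d * tau e]mulnC divnMDl // modnMDl.
  move=> -[cell res].
  have kE := divn_eq k.-1 d; rewrite -res addn0 in kE.
  have j2 : 1 < k.-1 %/ d.
    by rewrite ltn_divRL ?/dvdn -?res // mul1n; lia.
  have nD : ~~ occupied (tau e + (k.-1 %/ d).-1).
    apply: comp_endsP => //; first lia.
    by apply: leq_ltn_trans kdk; rewrite leq_pmul2l // leq_pred.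
  case/negP: nD.
  apply/occupiedP; exists e'; first exact: EI.
  have : tau e' + 1 == tau e + (k.-1 %/ d).-1 + 1 %[mod N].
    by rewrite cell -addnA addn1 prednK.
  by rewrite eqn_modDr modn_small // => /eqP.
rewrite -cP1 -cP2 -cP3 -(cardsU_disjoint d12) -cardsU_disjoint; last first.
  by rewrite -setI_eq0 setIUl !disjoint_setI0 ?setU0.
apply: subset_leq_card; rewrite !subUset; apply/andP; split; first (apply/andP; split).
- apply/subsetP => _ /imsetP[[e a] /setXP[/= eI _] ->]; apply/bigcupP; exists e => //.
  by apply: posn_slot => /=; have := ltn_ord a; lia.
- apply/subsetP => _ /imsetP[e /EI eI ->]; apply/bigcupP; exists e => //.
  by rewrite mulnDr muln1; apply: posn_slot; lia.
apply/subsetP => _ /imsetP[e /BI eI ->]; apply/bigcupP; exists e => //.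
by apply: posn_slot; lia.
Qed.

(** The slots left to [H] are never occupied, so every edge reaches a run end in fewer than [2 * L]
    steps; a run end and a number of steps determine the edge. *)
Lemma leq_card_run_ends : 0 < L <= N -> (forall e, e \in I -> ~~ hslot (tau e)) ->
  #|I| <= 2 * L * #|run_ends|.
Proof.
move=> LN Ih.
pose F (u : V * 'I_(2 * L)) := [set e in I | (tau e + u.2) %% N == tau u.1].
apply: (@leq_trans (\sum_(u in setX run_ends [set: 'I_(2 * L)]) 1)); last first.
  by rewrite sum1_card cardsX cardsT card_ord mulnC.
apply: (@leq_trans #|\bigcup_(u in setX run_ends [set: 'I_(2 * L)]) F u|); last first.
  apply: leq_trans (leq_card_bigcup _ _) _; apply: leq_sum => u _.
  apply/card_le1_eqP => e e'; rewrite !inE => /andP[eI /eqP eE] /andP[e'I /eqP e'E].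
  apply: tau_inj => //; apply: val_inj => /=.
  have /eqP : tau e' + u.2 = tau e + u.2 %[mod N] by rewrite eE e'E.
  by rewrite eqn_modDr !modn_small // => /eqP.
apply: subset_leq_card; apply/subsetP => e eI.
have ex : exists j, ~~ occupied (tau e + j.+1).
  have [[|j] [j0 jh]] := hslot_near (tau e) LN => //; exists j.
  by apply/negP => /occupiedP[e' /Ih e'h e'E]; rewrite e'E jh in e'h.
case: (ex_minnP ex) => j jD jmin.
have jL : j < 2 * L.
  have [[|i] [i0 ih]] := hslot_near (tau e) LN => //.
  apply: leq_trans (proj2 (andP i0)); rewrite ltnS; apply: jmin.
  by apply/negP => /occupiedP[e' /Ih e'h e'E]; rewrite e'E ih in e'h.
have /occupiedP[e' e'I e'E] : occupied (tau e + j).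
  case: j jD jmin {jL} => [|j] _ jmin; first by rewrite addn0 occupied_tau.
  by apply: contraT => /jmin; rewrite ltnn.
apply/bigcupP; exists (e', Ordinal jL); last by rewrite inE eI /= e'E.
by rewrite !inE e'I e'E occupied_modDl -addnA addn1 jD.
Qed.

(** Without component ends the next occupied slot always overlaps, so the pattern goes all around
    the cycle and every window of [k] consecutive slots contains an occupied one. *)
Lemma leq_slots_of_comp_ends0 : comp_ends = set0 -> N <= k * #|I|.
Proof.
move=> B0; have /set0Pn[e0 e0I] := I0.
have win s : exists2 c, c < k & occupied (tau e0 + s + c).
  elim: s => [|s [[|c] ck cD]].
  - by exists 0; [lia | rewrite !addn0 occupied_tau].
  - rewrite addn0 in cD; have /occupiedP[e eI eE] := cD.
    have [|j [j0 jk jD _]] := not_comp_ends eI; first by rewrite B0 inE.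
    exists j.-1; first by have := leq_pmull j d0; lia.
    rewrite addnS addSn -addnS prednK // -occupied_modDl -eE //.
  - by exists c; [lia | rewrite addnS addSn -addnS].
pose F (u : V * 'I_k) := [set s : 'I_N | (tau e0 + s + u.2) %% N == tau u.1].
rewrite -{1}(card_ord N) -cardsT.
apply: (@leq_trans (\sum_(u in setX I [set: 'I_k]) 1)); last first.
  by rewrite sum1_card cardsX cardsT card_ord mulnC.
apply: (@leq_trans #|\bigcup_(u in setX I [set: 'I_k]) F u|); last first.
  apply: leq_trans (leq_card_bigcup _ _) _; apply: leq_sum => u _.
  apply/card_le1_eqP => s s'; rewrite !inE => /eqP sE /eqP s'E.
  have /eqP : tau e0 + s' + u.2 = tau e0 + s + u.2 %[mod N] by rewrite sE s'E.
  by rewrite eqn_modDr eqn_modDl !modn_small // => /eqP/val_inj.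
apply: subset_leq_card; apply/subsetP => s _.
have [c ck /occupiedP[e eI eE]] := win s.
by apply/bigcupP; exists (e, Ordinal ck); rewrite !inE ?eI // eE.
Qed.

End Pattern.

End Slots.

(** * Encoding and counting the orderings that request a given pattern *)

Section PatternCount.
Variables (d k N L : nat).
Hypotheses (d0 : 0 < d) (dk : d + 2 <= k) (N0 : 0 < N) (kN : k <= d * N).
Let n := d * N.
Let k0 : 0 < k. Proof. by apply: leq_trans dk; rewrite addn2. Qed.
Local Notation slot := (slot d k N).
Local Notation hslot := (hslot N L).
Local Notation posn := (posn d0 N0).
Implicit Types (x : {perm 'I_n}) (e : {set 'I_n}) (I : {set {set 'I_n}}).

Definition random_edges x : {set {set 'I_n}} :=
  [set x @: slot i | i : 'I_N & ~~ hslot i].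

Let i0 : 'I_N := Ordinal N0.
Let c0 : 'I_k := Ordinal k0.

Definition slot_of x e : 'I_N :=
  odflt i0 [pick i : 'I_N | ~~ hslot i && (x @: slot i == e)].

Lemma slot_ofP x e : e \in random_edges x ->
  ~~ hslot (slot_of x e) /\ x @: slot (slot_of x e) = e.
Proof.
move=> /imsetP[i]; rewrite inE => ih ->; rewrite /slot_of.
case: pickP => [j /andP[jh /eqP jE]|/(_ i)]; first by [].
by rewrite ih eqxx.
Qed.

Lemma slot_of_inj I x : I \subset random_edges x -> {in I &, injective (slot_of x)}.
Proof.
move=> /subsetP Ix e e' /Ix/slot_ofP[_ eE] /Ix/slot_ofP[_ e'E] ee'.
by rewrite -eE -e'E ee'.
Qed.

Lemma card_random_edge x e : e \in random_edges x -> #|e| = k.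
Proof.
by move=> /slot_ofP[_ <-]; rewrite card_imset ?card_slot //; apply: perm_inj.
Qed.

Definition offset x e (u : 'I_n) : 'I_k :=
  odflt c0 [pick c : 'I_k | x (posn (d * slot_of x e + c)) == u].

Lemma offsetP x e u : e \in random_edges x -> u \in e ->
  (x^-1)%g u = posn (d * slot_of x e + offset x e u).
Proof.
move=> /slot_ofP[_ eE] ue; apply: (@perm_inj _ x); rewrite permKV /offset.
case: pickP => [c /eqP //|].
move: ue; rewrite -{1}eE => /imsetP[_ /(slotP k d0 N0)[c ->] ->] /(_ c).
by rewrite eqxx.
Qed.

(** The slots of the edges in [B] and, for each edge of [I], the arrangement of its vertices within
    its slot. The default values elsewhere keep the number of codes down to
    [N ^ #|B| * (k ^ k) ^ #|I|]. *)
Definition code I (B : {set {set 'I_n}}) x :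
    {ffun {set 'I_n} -> 'I_N} * {ffun {set 'I_n} -> {ffun 'I_k -> 'I_k}} :=
  ([ffun e => if e \in B then slot_of x e else i0],
   [ffun e : {set 'I_n} =>
     if e \in I then [ffun c : 'I_k => offset x e (nth (posn 0) (enum e) c)]
     else [ffun=> c0]]).

Definition codes I (B : {set {set 'I_n}}) :=
  setX [set f in pffun_on i0 (mem B) (@predT 'I_N)]
       [set g in pffun_on [ffun=> c0] (mem I) (@predT {ffun 'I_k -> 'I_k})].

Lemma code_in I B x : code I B x \in codes I B.
Proof.
rewrite inE /= !inE; apply/andP; split; apply/pffun_onP; split=> //.
  by apply/supportP => e eB; rewrite ffunE (negPf eB).
by apply/supportP => e eB; rewrite ffunE (negPf eB).
Qed.

Lemma card_codes I B : #|codes I B| = N ^ #|B| * (k ^ k) ^ #|I|.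
Proof.
by rewrite cardsX !cardsE !card_pffun_on card_ffun !card_ord.
Qed.

(* The code determines the positions of the vertices of the edges in [B]; an edge
   outside [B] shares a vertex with a later edge of the pattern, whose position and
   offset then determine its slot. *)
Lemma code_positions I (B : {set {set 'I_n}}) x0 x x1 :
  I \subset random_edges x0 -> I \subset random_edges x -> I \subset random_edges x1 ->
  comp_ends d k I (slot_of x0) \subset B -> B \subset I -> B != set0 ->
  code I B x = code I B x1 ->
  forall e u, e \in I -> u \in e -> (x^-1)%g u = (x1^-1)%g u.
Proof.
move=> Ix0 Ix Ix1 endB BI /set0Pn[eb ebB] [/ffunP codeB /ffunP codeI].
pose good e := forall u, u \in e -> (x^-1)%g u = (x1^-1)%g u.
have off_eq e u : e \in I -> u \in e -> offset x e u = offset x1 e u.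
  move=> eI ue; have ck : index u (enum e) < k.
    by rewrite -(card_random_edge (subsetP Ix e eI)) cardE index_mem mem_enum.
  have := codeI e; rewrite !ffunE eI => /ffunP/(_ (Ordinal ck)).
  by rewrite !ffunE /= nth_index // mem_enum.
have good_slot e : e \in I -> slot_of x e = slot_of x1 e -> good e.
  move=> eI se u ue.
  by rewrite !(offsetP _ ue) ?(subsetP Ix) ?(subsetP Ix1) // se off_eq.
have good_step e e' u : e \in I -> e' \in I -> u \in e -> u \in e' -> good e' -> good e.
  move=> eI e'I ue ue' /(_ u ue') gu; apply: good_slot => //.
  move: gu; rewrite !(offsetP _ ue) ?(subsetP Ix) ?(subsetP Ix1) // off_eq //.
  by move=> gu; apply: val_inj; apply: posn_inj gu.
(* Induction on the number [s] of steps from the slot of [e] forward to that of [eb], in the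
   reference ordering [x0]. *)
have chain s e : e \in I -> (slot_of x0 e + s) %% N = slot_of x0 eb -> good e.
  elim/ltn_ind: s e => s IHs e eI eE.
  have [eB|eB] := boolP (e \in B).
    by apply: good_slot => //; have := codeB e; rewrite !ffunE eB.
  have ebI : eb \in I by apply: (subsetP BI).
  have eend : e \notin comp_ends d k I (slot_of x0) by apply: contra eB; apply/subsetP.
  have [j [jp jk jD jmin]] := not_comp_ends d0 eI eend.
  have s0 : 0 < s.
    case: (posnP s) => // s0; case/negP: eB; rewrite s0 addn0 modn_small // in eE.
    by rewrite (slot_of_inj Ix0 eI ebI (val_inj eE)).
  have js : j <= s by apply: jmin => //; apply/occupiedP; exists eb.
  have /occupiedP[e' e'I e'E] := jD.
  have e0 f : f \in I -> x0 @: slot (slot_of x0 f) = f.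
    by move=> fI; have [] := slot_ofP (subsetP Ix0 f fI).
  (* The first vertex in the slot of [e'] also lies in [e], because [d * j < k]. Sharing it is a
     property of the two edges alone, hence usable for [x] and [x1]. *)
  apply: (good_step e e' (x0 (posn (d * slot_of x0 e + d * j)))) => //.
  - by have := imset_f x0 (posn_slot d0 N0 (slot_of x0 e) jk); rewrite e0.
  - have := imset_f x0 (posn_slot d0 N0 (slot_of x0 e') k0).
    by rewrite e0 // addn0 e'E posn_mulmod mulnDr.
  - apply: (IHs (s - j)) => //; first by rewrite ltn_subrL jp.
    by rewrite e'E modnDml -addnA subnKC.
move=> e u eI; apply: (chain (N - slot_of x0 e + slot_of x0 eb)) => //.
by rewrite addnA subnKC 1?ltnW // modnDl modn_small.
Qed.

Section Count.
Variable Om : {set {perm 'I_n}}.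
Variables (R : realFieldType) (C : R).
Hypothesis C1 : (1 <= C)%R.
Hypothesis spread : forall (J : {set 'I_n}) x0,
  (#|[set x in Om | [forall j in J, x j == x0 j]]|%:R * n%:R ^+ #|J|
     <= C ^+ #|J| * #|Om|%:R)%R.

(** Orderings with the same code agree on the positions of all vertices of [cover I], so each class
    is bounded by the vertex spread at these positions. *)
Lemma card_pattern_codes I (B : {set {set 'I_n}}) x0 : I \subset random_edges x0 ->
  comp_ends d k I (slot_of x0) \subset B -> B \subset I -> B != set0 ->
  (#|[set x in Om | I \subset random_edges x]|%:R * n%:R ^+ #|cover I|
     <= (N ^ #|B| * (k ^ k) ^ #|I|)%:R * (C ^+ #|cover I| * #|Om|%:R))%R.
Proof.
move=> Ix0 endB BI B0; rewrite -(@card_codes I B).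
pose Q := [set x in Om | I \subset random_edges x]; rewrite -/Q.
rewrite -sum1_card (partition_big (code I B) (mem (codes I B))) /=; last first.
  by move=> x _; apply: code_in.
rewrite natr_sum mulr_suml -sumr_const mulr_suml; apply: ler_sum => c _.
have [x1 /andP[x1Q /eqP x1c]|noQ] :=
  pickP (fun x => (x \in Q) && (code I B x == c)); last first.
  by rewrite big_pred0 // mul0r mul1r mulr_ge0 // exprn_ge0 // (le_trans ler01).
have x1I : I \subset random_edges x1 by move: x1Q; rewrite inE => /andP[].
pose J := (x1^-1)%g @: cover I.
have cJ : #|J| = #|cover I| by rewrite card_imset //; apply: perm_inj.
rewrite mul1r -cJ; apply: le_trans (spread J x1).
apply: ler_wpM2r; first by rewrite exprn_ge0.
rewrite sum1dep_card ler_nat; apply: subset_leq_card; apply/subsetP => x.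
rewrite !inE => /andP[/andP[xO xI] /eqP xc]; rewrite xO /=; apply/forall_inP => j.
move=> /imsetP[u /bigcupP[e eI ue] ->].
have <- : (x^-1)%g u = (x1^-1)%g u.
  by apply: (code_positions Ix0 xI x1I endB BI B0 _ eI ue); rewrite xc.
rewrite permKV; have -> : (x^-1)%g u = (x1^-1)%g u.
  by apply: (code_positions Ix0 xI x1I endB BI B0 _ eI ue); rewrite xc.
by rewrite permKV.
Qed.

(** [g] is a surplus of covered vertices: beyond the [d] per edge, and beyond the [#|B|] that pay
    for the [N ^ #|B|] placements of the clusters. *)
Lemma card_pattern I : 0 < L -> 2 * L * k < N -> I != set0 ->
  exists g, #|I| <= 4 * L * g /\
  (#|[set x in Om | I \subset random_edges x]|%:R * n%:R ^+ (d * #|I| + g)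
     <= ((k ^ k)%:R * C ^+ k) ^+ #|I| * #|Om|%:R)%R.
Proof.
move=> L0 LkN I0.
have C0 : (0 <= C)%R by apply: le_trans ler01 C1.
have acE (a b c o : R) : (a * b * (c * o) = b * o * (c * a))%R by ring.
have acE' (a b c o : R) : (b * c * o * a = b * o * (c * a))%R by ring.
have [noQ|/set0Pn[x0]] := eqVneq [set x in Om | I \subset random_edges x] set0.
  exists #|I|; split; first by rewrite leq_pmull // muln_gt0.
  by rewrite noQ cards0 mul0r mulr_ge0 // exprn_ge0 // mulr_ge0 ?exprn_ge0.
rewrite inE => /andP[_ Ix0].
have LN : 0 < L <= N.
  by rewrite L0; apply: leq_trans (ltnW LkN); rewrite -mulnA mulnCA leq_pmulr // muln_gt0.
set tau := slot_of x0; have tauI : {in I &, injective tau} := slot_of_inj Ix0.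
have cvr : cover I = x0 @: (\bigcup_(e in I) slot (tau e)).
  have -> : x0 @: (\bigcup_(e in I) slot (tau e)) = \bigcup_(e in I) (x0 @: slot (tau e)).
    by apply: (big_morph (fun A : {set 'I_n} => x0 @: A) (imsetU _) (imset0 _)).
  rewrite /cover; apply: eq_bigr => e eI.
  by have [_ ->] := slot_ofP (subsetP Ix0 e eI).
have := card_cover_slots_ge d0 dk N0 kN tauI I0.
rewrite -(card_imset _ (@perm_inj _ x0)) -cvr.
have hI e : e \in I -> ~~ hslot (tau e).
  by move=> eI; have [] := slot_ofP (subsetP Ix0 e eI).
have := leq_card_run_ends d0 dk N0 kN tauI LN hI.
set t := #|I|; set E := #|run_ends I tau|; set v := #|cover I| => tE vE.
have [B [g [endB BI B0 tg vg]]] : exists (B : {set {set 'I_n}}) (g : nat),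
  [/\ comp_ends d k I tau \subset B,
    B \subset I, B != set0, t <= 4 * L * g & d * t + g + #|B| <= v].
  have [B0|B0] := eqVneq (comp_ends d k I tau) set0; last first.
    exists (comp_ends d k I tau), E; split=> //.
      by apply/subsetP => e; rewrite inE => /andP[].
    by apply: leq_trans tE _; rewrite !leq_mul2r /= !orbT.
  (* If the pattern closes up around the cycle, any single edge anchors the code, at the price of
     one run end. There are at least two: [2 * L * k < N <= k * t] gives [t > 2 * L]. Then
     [E <= 2 * E.-1], whence the constant [4 * L]. *)
  have /set0Pn[e eI] := I0.
  have Nt := leq_slots_of_comp_ends0 d0 dk N0 kN I0 B0; rewrite -/t in Nt.
  have E1 : 1 < E.
    rewrite ltnNge; apply/negP => E1; have t2 : t <= 2 * L.
      by apply: leq_trans tE _; rewrite -[X in _ <= X]muln1 leq_mul2l E1 orbT.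
    have : k * t <= k * (2 * L) by rewrite leq_mul2l t2 orbT.
    by rewrite leqNgt => /negP; apply; apply: leq_trans Nt; rewrite mulnC.
  exists [set e], E.-1; rewrite B0 sub0set sub1set cards1; split=> //.
  - by apply/set0Pn; exists e; rewrite inE.
  - apply: leq_trans tE _; have -> : 4 * L = 2 * L * 2 by lia.
    by rewrite -[X in _ <= X]mulnA leq_mul2l; apply/orP; right; lia.
  - by move: vE; rewrite B0 cards0; lia.
exists g; split=> //.
have vk : v <= k * t.
  rewrite mulnC -sum_nat_const; apply: leq_trans (leq_card_bigcup _ _) _.
  by apply: leq_sum => e eI; rewrite (card_random_edge (subsetP Ix0 e eI)).
have := card_pattern_codes Ix0 endB BI B0.
set q := (#|_|%:R)%R; rewrite -/t -/v => le1.
have nR : (1 <= n%:R :> R)%R by rewrite ler1n muln_gt0 d0.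
have nB : (0 < n%:R ^+ #|B| :> R)%R by rewrite exprn_gt0 // (lt_le_trans ltr01).
rewrite -(ler_pM2r nB) -mulrA -exprD.
apply: (@le_trans _ _ (q * n%:R ^+ v)%R).
  by apply: ler_wpM2l; rewrite ?ler0n // ler_weXn2l.
apply: le_trans le1 _; rewrite natrM [(N ^ _)%:R%R]natrX [((k ^ k) ^ _)%:R%R]natrX.
rewrite exprMn -exprM; set kk := ((k ^ k)%:R ^+ t)%R; set om := (#|Om|%:R)%R.
rewrite acE acE'.
apply: ler_wpM2l; first by rewrite mulr_ge0 ?exprn_ge0.
apply: ler_pM; rewrite ?exprn_ge0 //; first by rewrite ler_weXn2l.
by rewrite lerXn2r ?nnegrE // ler_nat leq_pmull.
Qed.

End Count.

End PatternCount.

(** * The union of a dense graph and a random graph *)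

Local Open Scope ring_scope.

Lemma bernoulli_compl_le (R : realFieldType) (p : R) r : 0 <= p <= 1 ->
  1 - (1 - p) ^+ r <= r%:R * p.
Proof.
move=> /andP[p0 p1]; elim: r => [|r IHr]; first by rewrite expr0 subrr mul0r.
rewrite exprS -[r.+1%:R]natr1.
have : 0 <= (1 - p) ^+ r <= 1.
  by rewrite exprn_ge0 ?subr_ge0 // exprn_ile1 ?subr_ge0 // lerBlDr lerDl.
by move=> /andP[y0 y1]; nra.
Qed.

Lemma hamilton_of_slots k l N (x : {perm 'I_((k - l) * N)})
    (G : {set {set 'I_((k - l) * N)}}) :
  (0 < k - l)%N -> (0 < N)%N -> (k <= (k - l) * N)%N ->
  (forall i, (i < N)%N -> x @: slot (k - l) k N i \in G) ->
  has_hamilton_lcycle k l G.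
Proof.
move=> d0 N0 kN xG; set n := ((k - l) * N)%N in x G xG *.
pose y : {ffun 'I_#|'I_n| -> 'I_n} := [ffun j => x (cast_ord (card_ord n) j)].
have yE i : lcycle_edge k l y i = x @: slot (k - l) k N i.
  apply/setP => u; apply/imsetP/imsetP => -[j].
    rewrite inE => /existsP[c /eqP jc] ->; exists (cast_ord (card_ord n) j).
      by rewrite inE; apply/existsP; exists c; rewrite /= jc card_ord.
    by rewrite ffunE.
  rewrite inE => /existsP[c /eqP jc] ->; exists (cast_ord (esym (card_ord n)) j).
    by rewrite inE; apply/existsP; exists c; rewrite /= jc card_ord.
  by rewrite ffunE cast_ordKV.
have edgeP e : e \in lcycle_edges k l y -> exists2 i, (i < N)%N & e = x @: slot (k - l) k N i.
  move=> /imsetP[i _ ->]; exists i; rewrite ?yE //.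
  by apply: leq_trans (ltn_ord i) _; rewrite card_ord /n mulKn.
apply/existsP; exists (lcycle_edges k l y); rewrite /is_lcycle; apply/and4P; split.
- by apply/subsetP => e /edgeP[i iN ->]; apply: xG.
- apply/subsetP => e /edgeP[i iN ->]; rewrite inE card_imset ?card_slot //.
  exact: perm_inj.
- by rewrite card_ord /n dvdn_mulr.
apply/existsP; exists y; rewrite eqxx andbT; apply/injectiveP => i j.
by rewrite !ffunE => /perm_inj/cast_ord_inj.
Qed.

Lemma gnp_bexp (R : realType) (T : finType) k (p : R) (P : pred {set {set T}}) :
  gnp_pr k p P = bexp (ksubsets T k) p (fun G => (P G)%:R).
Proof.
rewrite /gnp_pr /bexp big_mkcondr /=; apply: eq_bigr => G _.
by rewrite /bweight; case: ifP => _; rewrite ?mulr1 ?mulr0.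
Qed.

Lemma gnp_le1 (R : realType) (T : finType) k (p : R) (P : pred {set {set T}}) :
  0 <= p <= 1 -> gnp_pr k p P <= 1.
Proof.
move=> p01; rewrite gnp_bexp -[leRHS](bexp_cst (ksubsets T k) p).
by apply: ler_bexp => // G _; case: (P G).
Qed.

Lemma card_random_edges_le d k N L (x : {perm 'I_(d * N)}) :
  (#|random_edges k L x| <= N)%N.
Proof.
apply: leq_trans (leq_imset_card _ _) _; rewrite -[X in (_ <= X)%N](card_ord N).
exact: max_card.
Qed.

(** * The probability bound for a fixed number of vertices *)

Section FixedOrder.
Variables (R : realType) (k l N L : nat).
Local Notation d := (k - l)%N.
Local Notation n := (d * N)%N.
Variables (H : {set {set 'I_n}}) (eps c s : R).
Hypotheses (hl : (2 <= l)%N) (d0 : (0 < d)%N) (LkN : (2 * L * k < N)%N).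
Hypotheses (kH : kgraph k H) (eps0 : 0 < eps).
Hypothesis H_dense : eps * n%:R ^+ k <= #|H|%:R.
Hypothesis L_large : 2 * k%:R <= eps * L%:R.
Hypothesis c_fact :
  forall F v : nat, (v <= F)%N -> F%:R ^+ v * (F - v)`!%:R <= c ^+ v * F`!%:R.
Hypotheses (s1 : 1 <= s) (sn : s ^+ (4 * L) <= n%:R).

Let dk : (d + 2 <= k)%N. Proof. lia. Qed.
Let k0 : (0 < k)%N. Proof. lia. Qed.
Let N0 : (0 < N)%N. Proof. exact: leq_ltn_trans LkN. Qed.
Let n0 : (0 < n)%N. Proof. by rewrite muln_gt0 d0. Qed.

Let Hk e : e \in H -> #|e| = k.
Proof. by move=> /(subsetP kH); rewrite inE => /eqP. Qed.

Let eps1 : eps <= 1.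
Proof.
have : (#|H| <= n ^ k)%N.
  apply: leq_trans (subset_leq_card kH) _; rewrite card_draws card_ord.
  apply: leq_trans (ffact_leq_exp _ _); rewrite -bin_ffact leq_pmulr //.
  exact: fact_gt0.
rewrite -(ler_nat R) natrX => /(le_trans H_dense).
by rewrite -[leRHS]mul1r ler_pM2r // exprn_gt0 // ltr0n.
Qed.

Let kL : (2 * k <= L)%N.
Proof.
rewrite -(ler_nat R) natrM; apply: le_trans L_large _.
by rewrite ler_piMl // ler0n.
Qed.

Let L0 : (0 < L)%N. Proof. by move: k0 kL; lia. Qed.

Let kN : (k <= n)%N.
Proof.
apply: (@leq_trans N); last by rewrite leq_pmull.
by apply: leq_trans (ltnW LkN); rewrite leq_pmull // muln_gt0.
Qed.

Let m := (N %/ L)%N.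

Definition hblock (i : 'I_m) : {set 'I_n} := slot d k N (L * i).

(** As [k <= L], the [i]-th block stays inside the [i]-th interval of [d * L] positions without
    wrapping around; this makes the blocks disjoint. *)
Lemma hblock_cell (i : 'I_m) (j : 'I_n) : j \in hblock i -> (j %/ (d * L))%N = i.
Proof.
rewrite inE => /existsP[a /eqP ->].
have aL : (a < d * L)%N.
  apply: leq_trans (ltn_ord a) _; apply: leq_trans (_ : L <= _)%N; first by move: kL; lia.
  by rewrite leq_pmull.
have iN : (d * L * i.+1 <= n)%N.
  rewrite -mulnA leq_mul2l; apply/orP; right.
  apply: leq_trans (leq_divM N L); rewrite mulnC leq_mul2r; apply/orP; right.
  exact: ltn_ord.
rewrite modn_small; last by apply: leq_trans iN; rewrite mulnS mulnA addnC ltn_add2r.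
by rewrite mulnA mulnC divnMDl ?muln_gt0 ?d0 // divn_small // addn0.
Qed.

Let b_disj i j : i != j -> [disjoint hblock i & hblock j].
Proof.
move=> ij; apply/pred0P => u /=; apply/negP => /andP[/hblock_cell ui /hblock_cell uj].
by case/eqP: ij; apply: val_inj; rewrite /= -ui -uj.
Qed.

Let bk i : #|hblock i| = k. Proof. exact: card_slot. Qed.

Let mk_small : (m * k)%:R <= eps / 2 * n%:R.
Proof.
have mL : (m * L)%:R <= n%:R :> R.
  by rewrite ler_nat (leq_trans (leq_divM _ _)) // leq_pmull.
rewrite !natrM in mL *.
have m0 : 0 <= m%:R :> R by [].
have := ler_wpM2l m0 L_large; have := ler_wpM2l (ltW eps0) mL; lra.
Qed.

Let mkn : (2 * m * k <= n)%N.
Proof.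
rewrite -(ler_nat R) -mulnA natrM; move: mk_small.
have := ler_wpM2r (ler0n R n) eps1; lra.
Qed.

Let Om := block_perms H hblock set0.
Let C := 4 * c / eps.

Let T0 : (0 < #|'I_n|)%N. Proof. by rewrite card_ord. Qed.
Let H_dense' : eps * #|'I_n|%:R ^+ k <= #|H|%:R. Proof. by rewrite card_ord. Qed.
Let mk_small' : (m * k)%:R <= eps / 2 * #|'I_n|%:R. Proof. by rewrite card_ord. Qed.

Let Om_gt0 : (0 < #|Om|)%N.
Proof. exact: (block_perms_gt0 Hk bk b_disj k0 eps0 T0 H_dense' mk_small'). Qed.

Let C1 : 1 <= C.
Proof.
have c1 : 1 <= c by have := c_fact (leqnn 1); rewrite !expr1 !mulr1.
rewrite /C ler_pdivlMr // mul1r; move: eps1 c1; lra.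
Qed.

(** The spread parameter [q]. The factor [s], at most the [4 * L]-th root of [n], is the gain per
    edge drawn from the surplus [g] by [#|I| <= 4 * L * g]. *)
Definition pattern_density : R := (k ^ k)%:R * C ^+ k / (n%:R ^+ d * s).

Lemma pattern_density_ge0 : 0 <= pattern_density.
Proof.
rewrite /pattern_density divr_ge0 ?mulr_ge0 ?exprn_ge0 ?ler0n //.
  exact: le_trans C1.
exact: le_trans s1.
Qed.

Lemma pattern_mass (I : {set {set 'I_n}}) :
  #|[set x in Om | I \subset random_edges k L x]|%:R
    <= pattern_density ^+ #|I| * #|Om|%:R.
Proof.
have [->|I0] := eqVneq I set0.
  rewrite cards0 expr0 mul1r ler_nat; apply: subset_leq_card.
  by apply/subsetP => x; rewrite inE => /andP[].
have spread (J : {set 'I_n}) (x0 : {perm 'I_n}) :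
    #|[set x in Om | [forall j in J, x j == x0 j]]|%:R * n%:R ^+ #|J|
      <= C ^+ #|J| * #|Om|%:R.
  have mkT : (2 * m * k <= #|'I_n|)%N by rewrite card_ord.
  have := vertex_spread Hk bk b_disj k0 eps0 T0 H_dense' mk_small' J x0 eps1 mkT c_fact.
  by rewrite card_ord.
have [g [Ig]] := card_pattern d0 dk N0 kN C1 spread L0 LkN I0.
set Q := #|_|%:R => le1.
have n1 : 0 < n%:R :> R by rewrite ltr0n.
have s0 : 0 < s by apply: lt_le_trans s1.
rewrite /pattern_density expr_div_n mulrAC ler_pdivlMr; last first.
  by rewrite exprn_gt0 // mulr_gt0 // exprn_gt0.
apply: le_trans le1; apply: ler_wpM2l; first exact: ler0n.
rewrite exprMn -exprM exprD; apply: ler_wpM2l; first by rewrite exprn_ge0.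
apply: (@le_trans _ _ (s ^+ (4 * L * g))); first by rewrite ler_weXn2l.
by rewrite exprM lerXn2r // nnegrE ?exprn_ge0 // ltW.
Qed.

(** The uniform measure on [Om] is spread, and an ordering requests at most [N < 2 ^ r] edges, so
    [r] rounds of density [p'] suffice; together their density is at most [r * p' <= p]. *)
Lemma gnp_hamilton_ge (p p' : R) (r : nat) : (N < 2 ^ r)%N -> 0 < p' < 1 ->
  r%:R * p' <= p <= 1 -> 4 * pattern_density <= p' ->
  1 - r%:R * (4 * pattern_density / p') <=
    gnp_pr k p (fun G => has_hamilton_lcycle k l (H :|: G)).
Proof.
move=> Nr /andP[p'0 p'1] /andP[pp' p1] qp.
set E := ksubsets 'I_n k.
pose miss (G : {set {set 'I_n}}) : R :=
  (~~ [exists x in Om, random_edges k L x \subset G])%:R.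
have Om0 : #|Om|%:R != 0 :> R by rewrite pnatr_eq0 -lt0n.
have rE x e : e \in random_edges k L x -> e \in E.
  by move=> xe; rewrite inE (card_random_edge d0 N0 kN xe).
have le1 : bexp E (1 - (1 - p') ^+ r) miss <= r%:R * (4 * pattern_density / p').
  have mu0 (x : {perm 'I_n}) : 0 <= #|Om|%:R^-1 :> R by rewrite invr_ge0.
  have p'01 : 0 < p' <= 1 by rewrite p'0 ltW.
  have := @spread_missed R _ E _ (fun=> #|Om|%:R^-1) mu0 p' pattern_density p'01
    pattern_density_ge0 qp r Om (random_edges k L).
  have -> : \sum_(x in Om) #|Om|%:R^-1 = 1 :> R.
    by rewrite sumr_const -[LHS]mulr_natl divff.
  rewrite mulr1; apply => //.
  - by move=> x _; apply/subsetP => e; apply: rE.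
  - by move=> x _; apply: leq_ltn_trans (card_random_edges_le _ _ _) Nr.
  move=> I; rewrite sumr_const -[leLHS]mulr_natl ler_pdivrMr ?lt0r ?Om0 ?ler0n //.
  apply: le_trans (pattern_mass I); rewrite ler_nat; apply: subset_leq_card.
  by apply/subsetP => x /andP[xO Ix]; rewrite inE xO.
have pr0 : 0 <= 1 - (1 - p') ^+ r.
  by rewrite subr_ge0 exprn_ile1 ?subr_ge0 ?(ltW p'1) // lerBlDr lerDl ltW.
have pr1 : 1 - (1 - p') ^+ r < 1 by rewrite ltrBlDr ltrDl exprn_gt0 // subr_gt0.
have prp : 1 - (1 - p') ^+ r <= p.
  by apply: le_trans pp'; apply: bernoulli_compl_le; rewrite !ltW.
have p01 : 0 <= p <= 1 by rewrite p1 (le_trans pr0).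
have le2 : bexp E p miss <= bexp E (1 - (1 - p') ^+ r) miss.
  apply: ler_bexp_mono => //; first by rewrite pr0.
  move=> G G' GG'; rewrite ler_nat; case: existsP => // nG'; case: existsP => // -[x].
  move=> /andP[xO xG]; case: nG'; exists x; rewrite xO.
  exact: subset_trans GG'.
(* Pointwise, either [G] misses every requested set or [H :|: G] contains the cycle. *)
rewrite lerBlDr -[X in X <= _](bexp_cst E p).
rewrite (le_trans _ (lerD (lexx _) (le_trans le2 le1))) //.
rewrite gnp_bexp -bexpD; apply: ler_bexp => // G _; rewrite /miss.
case: existsP => [[x /andP[xO xG]]|_]; last by rewrite lerDr ler0n.
rewrite (hamilton_of_slots (x := x)) ?addr0 // => i iN.
(* A reserved slot carries an edge of [H] since [x] lies in [Om]; any other slot carries a requested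
   edge, present in [G]. *)
rewrite inE; have [/andP[/dvdnP[j ->] jL]|ih] := boolP (hslot N L i).
  have jm : (j < m)%N by move: jL; rewrite ltn_pmul2r.
  have := xO; rewrite inE => /forall_inP/(_ (Ordinal jm)).
  by rewrite /hblock /= !inE [(L * j)%N]mulnC => ->.
apply/orP; right; apply: (subsetP xG); apply/imsetP; exists (Ordinal iN) => //.
by rewrite inE.
Qed.

End FixedOrder.

(** * Asymptotic estimates and the choice of constants *)

Unset Implicit Arguments.
Set Strict Implicit.
Set Printing Implicit Defensive.
From HB Require Import structures.
From mathcomp Require Import all_boot all_order all_algebra.
From mathcomp Require Import all_classical all_reals all_analysis.

Import Order.TTheory GRing.Theory Num.Theory.
Import numFieldNormedType.Exports.
Local Open Scope classical_set_scope.
Local Open Scope ring_scope.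

(** Induction on [v], with [(1 + 1 / F) ^ v <= e ^ (v / F) <= e] for [v <= F]. This supplies the
    constant [c = e] of the vertex spread. *)
Lemma expn_fact_le (R : realType) (F v : nat) : (v <= F)%N ->
  F%:R ^+ v * (F - v)`!%:R <= expR 1 ^+ v * F`!%:R :> R.
Proof.
elim: v F => [|v IHv] F vF; first by rewrite !expr0 subn0 !mul1r.
case: F vF => [|F] // vF.
rewrite subSS factS natrM exprS [expR 1 ^+ v.+1]exprS.
have step : F.+1%:R ^+ v <= expR 1 * F%:R ^+ v :> R.
  case: F vF {IHv} => [|F] vF.
    by move: vF; case: v => // _; rewrite !expr0 mulr1 (le_trans _ (expR_ge1Dx 1)) // lerDl.
  have F0 : 0 < F.+1%:R :> R by rewrite ltr0n.
  have -> : F.+2%:R = (1 + F.+1%:R^-1) * F.+1%:R :> R.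
    by rewrite mulrDl mul1r mulVf ?gt_eqF // natr1.
  rewrite exprMn; apply: ler_wpM2r; first by rewrite exprn_ge0.
  apply: (@le_trans _ _ (expR F.+1%:R^-1 ^+ v)).
    by rewrite lerXn2r ?nnegrE ?expR_ge0 ?expR_ge1Dx ?addr_ge0 ?invr_ge0.
  rewrite -expRM_natl ler_expR ler_pdivrMr // mul1r ler_nat.
  exact: vF.
have IH := IHv F vF.
apply: (@le_trans _ _ (F.+1%:R * (expR 1 * (F%:R ^+ v * (F - v)`!%:R)))).
  rewrite -mulrA; apply: ler_wpM2l; first exact: ler0n.
  by rewrite mulrA; apply: ler_wpM2r.
rewrite [leRHS](_ : _ = F.+1%:R * (expR 1 * (expR 1 ^+ v * F`!%:R))); last by ring.
by apply: ler_wpM2l => //; apply: ler_wpM2l => //; apply: expR_ge0.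
Qed.

(** From [2 ^ t <= n] and [1 + x <= expR x]: the logarithmic number of rounds costs only a small
    power of [n]. *)
Lemma trunc_log2_le_powR (R : realType) (a : R) (n : nat) : 0 < a -> (0 < n)%N ->
  (trunc_log 2 n).+1%:R <= (1 + (a * ln 2)^-1) * n%:R `^ a.
Proof.
move=> a0 n0; set t := trunc_log 2 n.
have ln20 : 0 < ln 2 :> R by rewrite ln_gt0 // ltr1n.
have na1 : 1 <= n%:R `^ a :> R.
  apply: (@le_trans _ _ (1 `^ a)); first by rewrite powR1.
  by rewrite ge0_ler_powR ?nnegrE ?ler0n ?ler1n // ltW.
have le1 : t%:R * (a * ln 2) <= n%:R `^ a.
  apply: (@le_trans _ _ ((2 ^ t)%:R `^ a)); last first.
    by rewrite ge0_ler_powR ?nnegrE ?ler0n ?ler_nat ?trunc_logP // ltW.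
  rewrite /powR pnatr_eq0 expn_eq0 /= natrX lnXn ?ltr0n //.
  apply: le_trans (expR_ge1Dx _).
  by rewrite -[ln 2 *+ t]mulr_natl mulrCA lerDr.
rewrite mulrDl mul1r -natr1 addrC; apply: lerD => //.
by rewrite mulrC ler_pdivlMr // mulr_gt0.
Qed.

Lemma powRN_eventually_le (R : realType) (a C e : R) : 0 < a -> 0 < C -> 0 < e ->
  exists n0 : nat, forall n : nat, (n0 <= n)%N -> C * n%:R `^ (- a) <= e.
Proof.
move=> a0 C0 e0; pose x := (C / e) `^ a^-1.
have x0 : 0 <= x by exact: powR_ge0.
exists (Num.bound x) => n nx.
have xn : x <= n%:R.
  by apply: (le_trans (ltW (archi_boundP x0))); rewrite ler_nat.
have : x `^ a <= n%:R `^ a by rewrite ge0_ler_powR ?nnegrE ?ler0n // ltW.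
rewrite /x -powRrM mulVf ?gt_eqF // powRr1; last by rewrite divr_ge0 // ltW.
have Ce0 : 0 < C / e by rewrite divr_gt0.
move=> le1; have na0 := lt_le_trans Ce0 le1.
by rewrite powRN ler_pdivrMr // mulrC -ler_pdivrMr.
Qed.

Theorem theorem1p7 (R : realType) (k l : nat) (hk : (3 <= k)%N)
    (hl : (2 <= l <= k - 1)%N) (eps : R) (heps : 0 < eps) :
  exists (eta : R) (C : nat), [/\ 0 < eta, (0 < C)%N &
    forall (H : forall n : nat, {set {set 'I_n}}) (p : nat -> R),
      (\forall n \near large_multiples (k - l),
         [/\ kgraph k (H n),
             eps * n%:R ^+ k <= #|H n|%:R,
             n%:R `^ (- (k - l)%:R - eta) <= p n
           & p n <= 1]) ->
      gnp_pr k (p n) (fun G => has_hamilton_lcycle k l (H n :|: G))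
        @[n --> large_multiples (k - l)] --> (1 : R)].
Proof.
have /andP[l2 lk] := hl.
have d0 : (0 < k - l)%N by lia.
set d := (k - l)%N.
have [L [L_large L1]] : exists L : nat, 2 * k%:R <= eps * L%:R /\ (0 < L)%N.
  exists (Num.bound (2 * k%:R / eps)).+1; split=> //.
  rewrite [leRHS]mulrC -ler_pdivrMr //; apply: ltW.
  apply: (@lt_le_trans _ _ (Num.bound (2 * k%:R / eps))%:R); last by rewrite ler_nat.
  by apply: archi_boundP; rewrite divr_ge0 ?mulr_ge0 ?ler0n // ltW.
have L0 : 0 < L%:R :> R by rewrite ltr0n.
(* The spread parameter gains [n ^ (- 2 * eta)] over [n ^ (- d)], as [2 * eta = 1 / (4 * L)].
   Conceding [n ^ (- eta)] to [p] leaves another [n ^ (- eta)] for the rounds. *)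
pose eta : R := (8 * L%:R)^-1.
have eta0 : 0 < eta by rewrite invr_gt0 mulr_gt0.
exists eta, 1%N; split=> // H p Hp.
(* The failure bound contains [r ^ 2 = O(n ^ (2 * a))]; against [n ^ (- eta)] with [eta = 4 * a]
   this leaves [n ^ (- 2 * a)]. *)
pose a := eta / 4.
have a0 : 0 < a by rewrite divr_gt0.
have [K KE K0] : exists2 K : R, K = (k ^ k)%:R * (4 * expR 1 / eps) ^+ k & 0 < K.
  exists ((k ^ k)%:R * (4 * expR 1 / eps) ^+ k) => //.
  rewrite mulr_gt0 ?ltr0n ?expn_gt0 ?exprn_gt0 ?divr_gt0 ?mulr_gt0 ?expR_gt0 //.
  by apply/orP; left; lia.
have [K' K'E K'0] : exists2 K' : R, K' = 1 + (a * ln 2)^-1 & 0 < K'.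
  exists (1 + (a * ln 2)^-1) => //.
  by rewrite addr_gt0 // invr_gt0 mulr_gt0 // ln_gt0 // ltr1n.
rewrite /large_multiples; apply/cvgrPdist_le => /= e e0.
have [n1 _ h1] : \forall n \near \oo, (d %| n)%N ->
    [/\ kgraph k (H n), eps * n%:R ^+ k <= #|H n|%:R,
        n%:R `^ (- d%:R - eta) <= p n & p n <= 1] := Hp.
have C30 : 0 < 4 * K * K' ^+ 2.
  by apply: mulr_gt0; [apply: mulr_gt0 | apply: exprn_gt0].
(* The bound by [e] gives the convergence; the bound by 1 yields [4 * q <= p']. *)
have e10 : 0 < Num.min e 1 by rewrite lt_min e0 ltr01.
have a20 : 0 < 2 * a by rewrite mulr_gt0.
have [n2 h2] := powRN_eventually_le R (2 * a) _ _ a20 C30 e10.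
(* [n1] comes from the hypotheses on [H] and [p], [n2] from the decay, and the last term gives
   [2 * L * k < N] and [1 < n]. *)
exists (maxn n1 (maxn n2 (d * (2 * L * k).+2))) => // n /=.
rewrite !geq_max => /andP[nn1 /andP[nn2 nn3]] dn.
have {h1} := h1 n nn1 dn; have {h2} := h2 n nn2.
case/dvdnP: dn => N; rewrite mulnC => nE; rewrite {n}nE in nn1 nn2 nn3 *.
set n := (d * N)%N in nn1 nn2 nn3 *.
move=> bnd [kH dense plo phi].
have N3 : ((2 * L * k).+2 <= N)%N by move: nn3; rewrite leq_pmul2l.
have N2 : (2 * L * k < N)%N by exact: ltnW N3.
have Nn : (N <= n)%N by rewrite leq_pmull.
have n1' : (1 < n)%N by apply: leq_trans (leq_trans N3 Nn).
have nR0 : 0 < n%:R :> R by rewrite ltr0n ltnW.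
have nneq0 : n%:R != 0 :> R by rewrite gt_eqF.
have nR1 : 1 <= n%:R :> R by rewrite ler1n ltnW.
pose s : R := n%:R `^ (2 * eta).
have s1 : 1 <= s.
  apply: (@le_trans _ _ (1 `^ (2 * eta))); first by rewrite powR1.
  by rewrite ge0_ler_powR ?nnegrE ?ler0n // mulr_ge0 // ltW.
have sn : s ^+ (4 * L) <= n%:R.
  rewrite -powR_mulrn ?powR_ge0 // -powRrM.
  rewrite (_ : 2 * eta * (4 * L)%:R = 1) ?powRr1 ?ler0n //.
  by rewrite natrM /eta; field; rewrite gt_eqF.
pose r := (trunc_log 2 n).+1.
pose p0 : R := n%:R `^ (- d%:R - eta).
have p00 : 0 < p0 by rewrite powR_gt0.
have r0 : 0 < r%:R :> R by rewrite ltr0n.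
(* The lower bound [p0] on [p n] is split evenly among the [r] rounds. *)
pose p' := p0 / r%:R.
pose q := pattern_density k l N eps (expR 1) s.
have qE : q = K * (n%:R `^ (- d%:R - eta) * n%:R `^ (- eta)).
  rewrite /q /pattern_density -KE -powRD; last by rewrite nneq0 implybT.
  rewrite (_ : - d%:R - eta - eta = - (d%:R + 2 * eta)); last by ring.
  rewrite powRN powRD; last by rewrite nneq0 implybT.
  by rewrite powR_mulrn ?ler0n.
have total : r%:R * (4 * q / p') <= Num.min e 1.
  apply: le_trans bnd.
  have -> : r%:R * (4 * q / p') = 4 * K * r%:R ^+ 2 * n%:R `^ (- eta).
    by rewrite qE /p' -/p0; field; rewrite !gt_eqF.
  have rK : r%:R <= K' * n%:R `^ a.
    by rewrite K'E; apply: trunc_log2_le_powR => //; rewrite ltnW.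
  have -> : n%:R `^ (- (2 * a)) = (n%:R `^ a) ^+ 2 * n%:R `^ (- eta).
    rewrite -powR_mulrn ?powR_ge0 // -powRrM -powRD; last by rewrite nneq0 implybT.
    by congr powR; rewrite /a; field.
  rewrite -[leLHS]mulrA -[leRHS]mulrA; apply: ler_wpM2l; first by rewrite mulr_ge0 // ltW.
  rewrite [leRHS]mulrA -exprMn; apply: ler_wpM2r; first exact: powR_ge0.
  by rewrite lerXn2r ?nnegrE ?ler0n // mulr_ge0 ?powR_ge0 ?(ltW K'0).
have p'0 : 0 < p' by rewrite divr_gt0.
have p01 : p0 <= 1 by apply: le_trans plo phi.
have r2 : 2 <= r%:R :> R.
  by rewrite ler_nat ltnS trunc_log_gt0.
have p'1 : p' < 1.
  by rewrite /p' ltr_pdivrMr // mul1r; lra.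
have qp : 4 * q <= p'.
  rewrite -[leRHS]mul1r -ler_pdivrMr //; apply: (@le_trans _ _ (r%:R * (4 * q / p'))).
    rewrite ler_peMl //; last by lra.
    by rewrite divr_ge0 ?(ltW p'0) // mulr_ge0 // qE !mulr_ge0 ?powR_ge0 // ltW.
  by apply: le_trans total _; rewrite ge_min lexx orbT.
have Nr : (N < 2 ^ r)%N.
  by apply: leq_ltn_trans Nn (trunc_log_ltn n _).
have pp' : r%:R * p' <= p n <= 1.
  by rewrite phi andbT /p' mulrC divfK ?gt_eqF.
have p'01 : 0 < p' < 1 by rewrite p'0.
have := @gnp_hamilton_ge R k l N L (H n) eps (expR 1) s l2 d0 N2 kH heps dense L_large
  (@expn_fact_le R) s1 sn (p n) p' r Nr p'01 pp' qp.
set pr := gnp_pr _ _ _ => prlo.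
have prhi : pr <= 1.
  by apply: gnp_le1; rewrite phi andbT (le_trans _ plo) // powR_ge0.
rewrite ger0_norm ?subr_ge0 // lerBlDr -lerBlDl.
apply: le_trans _ prlo; rewrite lerD2l lerN2.
by apply: le_trans total _; rewrite ge_min lexx.
Qed.
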